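(* Let $\psi:\mathbb{N}\to\mathbb{R}$ be any nonnegative function, and let $f:[0,\infty)\to\mathbb{R}$ be defined by \[ f(x)=\begin{cases}0 & \text{if } x=0,\\[2pt] x\cdot\exp\left\{\dfrac{\log x}{2\log(-\log x)}\right\} & \text{if } 0<x<1,\\[6pt] 1 & \text{if } x\ge 1.\end{cases} \] If \[ \sum_{n\in\mathbb{N}} f\!\left(\frac{\psi(n)}{n}\right)\varphi(n)=\infty, \] then $\lambda(W(\psi))=1$.
   Context: $\varphi$ denotes Euler's totient function and $\lambda$ denotes Lebesgue measure on $\mathbb{R}/\mathbb{Z}$. For each positive integer $n$, let \[ \mathcal{E}_n=\bigcup_{\substack{1\le a\le n\\ \gcd(a,n)=1}}\left(\frac{a-\psi(n)}{n},\frac{a+\psi(n)}{n}\right)\subseteq \mathbb{R}/\mathbb{Z}, \] and let $W(\psi)=\limsup_{n\to\infty}\mathcal{E}_n=\bigcap_{m=1}^\infty\bigcup_{n\ge m}\mathcal{E}_n$, the set of points of $\mathbb{R}/\mathbb{Z}$ lying in infinitely many of the sets $\mathcal{E}_n$. *)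

(* Defs.v *)
From HB Require Import structures.
From mathcomp Require Import all_boot all_order all_algebra generic_quotient.
From mathcomp Require Import all_classical all_reals all_analysis.

Set Implicit Arguments.
Unset Strict Implicit.
Unset Printing Implicit Defensive.

Import Order.TTheory GRing.Theory Num.Theory.
Import numFieldNormedType.Exports.

Local Open Scope classical_set_scope.
Local Open Scope quotient_scope.
Local Open Scope ring_scope.

Section circle.
Context {R : realType}.

Definition eq_mod1 (x y : R) : bool := x - y \is a Num.int.

Lemma eq_mod1_refl : reflexive eq_mod1.
Proof. by move=> x; rewrite /eq_mod1 subrr rpred0. Qed.

Lemma eq_mod1_sym : symmetric eq_mod1.
Proof. by move=> x y; rewrite /eq_mod1 -opprB rpredN. Qed.

Lemma eq_mod1_trans : transitive eq_mod1.
Proof.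
by move=> y x z xy yz; rewrite /eq_mod1 -(subrKA y) rpredD.
Qed.

Canonical eq_mod1_equiv := EquivRel eq_mod1 eq_mod1_refl eq_mod1_sym eq_mod1_trans.

End circle.

Definition circle (R : realType) := {eq_quot (@eq_mod1_equiv R)}.

HB.instance Definition _ (R : realType) := EqQuotient.on (circle R).
HB.instance Definition _ (R : realType) := Choice.on (circle R).

Definition to_circle (R : realType) (x : R) : circle R := \pi_(circle R) x.

HB.instance Definition _ (R : realType) :=
  isPointed.Build (circle R) (to_circle (0 : R)).

Section circle_measurable.
Context {R : realType}.

(* Quotient sigma-algebra: since to_circle is a local homeomorphism, these are
   exactly the Borel sets of R/Z. *)
Definition circle_measurable : set (set (circle R)) :=
  [set A | measurable ((@to_circle R) @^-1` A)].

Lemma circle_measurable0 : circle_measurable set0.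
Proof. by rewrite /circle_measurable /= preimage_set0. Qed.

Lemma circle_measurableC A : circle_measurable A -> circle_measurable (~` A).
Proof. by rewrite /circle_measurable /= preimage_setC; exact: measurableC. Qed.

Lemma circle_measurable_bigcup (F : (set (circle R))^nat) :
  (forall i, circle_measurable (F i)) -> circle_measurable (\bigcup_i F i).
Proof.
by move=> mF; rewrite /circle_measurable /= preimage_bigcup; exact: bigcupT_measurable.
Qed.

HB.instance Definition _ := @isMeasurable.Build default_measure_display (circle R)
  circle_measurable circle_measurable0 circle_measurableC circle_measurable_bigcup.

Lemma measurable_to_circle :
  measurable_fun setT (@to_circle R : measurableTypeR R -> circle R).
Proof. by move=> _ A mA; rewrite setTI. Qed.

(* Lebesgue measure on R/Z, computed on the fundamental domain [0, 1). *)
Definition circle_measure : set (circle R) -> \bar R :=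
  pushforward (mrestr (@lebesgue_measure R) (measurable_itv `[0%R, 1%R[))
    (@to_circle R : measurableTypeR R -> circle R).

Lemma circle_measure0 : circle_measure set0 = 0%E.
Proof. by rewrite /circle_measure /pushforward preimage_set0 measure0. Qed.

Lemma circle_measure_ge0 A : (0 <= circle_measure A)%E.
Proof. by rewrite /circle_measure /pushforward; exact: measure_ge0. Qed.

Lemma circle_measure_sigma_additive : semi_sigma_additive circle_measure.
Proof.
move=> F mF tF mUF; rewrite /circle_measure /pushforward preimage_bigcup.
apply: measure_semi_sigma_additive.
- by move=> n; exact: mF.
- apply/trivIsetP => /= i j _ _ ij; rewrite -preimage_setI.
  by move/trivIsetP : tF => /(_ _ _ _ _ ij) ->//; rewrite preimage_set0.
- by rewrite -preimage_bigcup.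
Qed.

HB.instance Definition _ := isMeasure.Build _ _ _ circle_measure
  circle_measure0 circle_measure_ge0 circle_measure_sigma_additive.

Lemma circle_measure_setT : circle_measure setT = 1%E.
Proof.
rewrite /circle_measure /pushforward preimage_setT /mrestr setTI.
by rewrite lebesgue_measure_itv /= lte_fin ltr01 oppr0 adde0.
Qed.

HB.instance Definition _ :=
  Measure_isProbability.Build _ _ _ circle_measure circle_measure_setT.

End circle_measurable.
Arguments circle_measure {R}.

Section approximation.
Context {R : realType}.
Implicit Type psi : nat -> R.

Definition approx_set psi (n : nat) : set (circle R) :=
  \bigcup_(a in [set a : nat | (1 <= a <= n)%N && coprime a n])
    [set to_circle x |
      x in `](a%:R - psi n) / n%:R, (a%:R + psi n) / n%:R[%classic].

(* The intersection over m >= 0 agrees with the one over m >= 1, the tail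
   unions being nonincreasing in m (besides, approx_set psi 0 is empty). *)
Definition limsup_approx psi : set (circle R) := lim_sup_set (approx_set psi).

(* The formula leaves the value at x = exp (-1) undefined, since
   ln (- ln x) = 0 there; division by zero being 0, weight (exp (-1)) is
   exp (-1). This value does not matter: whether the series below diverges is
   unaffected by finitely many of its terms, and approx_set psi n is the whole
   circle for n large with psi n / n = exp (-1). *)
Definition weight (x : R) : R :=
  if x == 0 then 0
  else if x < 1 then x * expR (ln x / (2 * ln (- ln x)))
  else 1.

End approximation.

(* Main.v *)
(* Write D(n) = psi(n)/n.  If D(n)^2 n >= 1 for infinitely many n, Legendre's
   sieve, whose error 2^omega(n) is n^o(1), shows that E_n is the whole circle
   for all large such n.  Otherwise D(n) < n^(-1/2) for n large, and the n with
   D(n) < n^(-3) contribute a convergent series, so one may assume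
   n^(-3) <= D(n) < n^(-1/2).

   Group the remaining n into scales 2^(4^k) <= n < 2^(4^(k+1)), and split each
   scale into classes according to the valuations of n at all primes p <= 2^k.
   The number of classes is at most 2^((2k+3) 2^(k+1)), which is smaller than
   the factor exp(- log D / (2 log(- log D))) lost in the weight.  Hence, by the
   pigeonhole principle, keeping only the richest class of each scale, and then
   only the scales of one parity, leaves a set A with sum_A D(n) phi(n) = oo.

   On A the sets E_n are quasi-independent on average.  If m and n lie in the
   same scale, then mn/gcd(m,n)^2 has only prime factors > 2^k, and the sum of
   1/p over the primes p > 2^k dividing m or n is bounded; so the number of
   pairs (a,b) with a/m close to b/n can be bounded by fixing c = an' - bm' > 0
   (where m = gm', n = gn', g = gcd(m,n)) and counting residues with the Chinese
   remainder theorem.  If they lie in different scales, then m^4 <= n, say, and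
   the sieve applies in each interval of E_m.

   Finally, let G be the complement in [0,1] of finitely many E_n.  Since G is a
   finite union of intervals, the later E_n equidistribute in G, and the second
   moment method on G gives later E_n that cover a part of G of measure at least
   c lambda(G)^2.  Iterating this, almost every point lies in some E_n with
   n >= N, for every N; no zero-one law is needed. *)
Require Import Defs.
From mathcomp Require Import all_boot all_order all_algebra.
From mathcomp Require Import all_classical all_reals all_analysis.
From mathcomp Require Import measurable_realfun ring lra zify.

Import Order.TTheory GRing.Theory Num.Theory.
Import numFieldNormedType.Exports.

Set Implicit Arguments.
Unset Strict Implicit.
Unset Printing Implicit Defensive.

Local Open Scope classical_set_scope.
Local Open Scope ring_scope.

(** * Legendre's sieve *)

Lemma sum_multiples (V : nmodType) (F : nat -> V) (p y : nat) : (0 < p)%N ->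
  \sum_(1 <= a < y.+1 | (p %| a)%N) F a =
  \sum_(1 <= b < (y %/ p).+1) F (p * b)%N.
Proof.
move=> p_gt0; elim: y => [|y IHy]; first by rewrite div0n !big_nil.
rewrite big_mkcond big_nat_recr //= -big_mkcond IHy divnS //.
case: (boolP (p %| y.+1)%N) => [p_dvd|_]; last by rewrite addr0.
rewrite add1n [RHS]big_nat_recr //=; congr (_ + F _).
by rewrite -{1}(divnK p_dvd) divnS // p_dvd mulnC.
Qed.

(** Among the [a] that survive [ps], the multiples of [p] are the [p * b] with [b <= y %/ p]
    surviving [ps]. So an error [e] for [ps] becomes [2 * e + 1] for [p :: ps], the 1 paying for the
    fractional part of [y / p]; this solves to [2 ^ s - 1]. *)
Lemma sieve_count (R : realFieldType) (ps : seq nat) (y : nat) :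
  all prime ps -> uniq ps ->
  `|(\sum_(1 <= a < y.+1 | all (fun p => ~~ (p %| a)%N) ps) 1)
     - y%:R * \prod_(p <- ps) (1 - p%:R^-1)| <= 2 ^+ size ps - 1 :> R.
Proof.
elim: ps y => [|p ps IH] y /=.
  move=> _ _; rewrite big_nil expr0 mulr1 subrr sumr_const_nat subn1 /=.
  by rewrite subrr normr0.
move=> /andP[p_pr ps_pr] /andP[p_ps ps_u].
have p_gt0 := prime_gt0 p_pr.
have split1 : \sum_(1 <= a < y.+1 | all (fun q => ~~ (q %| a)%N) ps) (1 : R) =
    \sum_(1 <= a < y.+1 | ~~ (p %| a)%N && all (fun q => ~~ (q %| a)%N) ps) 1
    + \sum_(1 <= a < (y %/ p).+1 | all (fun q => ~~ (q %| a)%N) ps) 1.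
  rewrite (bigID (fun a => p %| a)%N) /= addrC; congr (_ + _).
    by apply: eq_bigl => a; rewrite andbC.
  rewrite (eq_bigl (fun a => (p %| a)%N && all (fun q => ~~ (q %| a)%N) ps)).
    rewrite big_mkcondr /= sum_multiples // [RHS]big_mkcond; apply: eq_bigr => b _.
    congr (if _ then _ else _); apply: eq_in_all => q qps.
    have q_pr := allP ps_pr _ qps; rewrite Euclid_dvdM // dvdn_prime2 //.
    suff /negPf -> : q != p by [].
    by apply: contraNneq p_ps => <-.
  by move=> a; rewrite andbC.
set A := \sum_(_ <= _ < _ | _) _ in split1; set B := \sum_(_ <= _ < _ | _) _ in split1.
set C := \sum_(_ <= _ < _ | _) _ in split1.
rewrite [X in `|X - _|](_ : _ = A - C); last by rewrite split1 addrK.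
have := IH y ps_pr ps_u; have := IH (y %/ p)%N ps_pr ps_u.
rewrite -/A -/C big_cons; set P := \prod_(_ <- _) _.
have P01 : 0 <= P <= 1.
  rewrite /P big_seq; apply: (big_ind (fun v : R => 0 <= v <= 1)); first by rewrite ler01 lexx.
    by move=> u v /andP[u0 u1] /andP[v0 v1]; rewrite mulr_ge0 // mulr_ile1.
  move=> q /(allP ps_pr) /prime_gt0 q0.
  by rewrite subr_ge0 invf_le1 ?ltr0n // ler1n q0 lerBlDr lerDl invr_ge0 ler0n.
have pR : 0 < p%:R :> R by rewrite ltr0n.
have E : y%:R * p%:R^-1 - (y %/ p)%N%:R = (y %% p)%N%:R / p%:R :> R.
  by rewrite {1}(divn_eq y p) natrD natrM mulrDl mulfK ?gt_eqF //; ring.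
have r0 : (y %% p)%N%:R / p%:R >= 0 :> R by exact: divr_ge0.
have r1 : (y %% p)%N%:R / p%:R <= 1 :> R.
  by rewrite ler_pdivrMr // mul1r ler_nat ltnW // ltn_mod.
move: E r0 r1; set r := (y %% p)%N%:R / p%:R => E r0 r1 H1 H2.
rewrite [X in `|X|](_ : _ =
   (A - y%:R * P) - (C - (y %/ p)%N%:R * P) + r * P); last by rewrite -E; ring.
apply: le_trans (ler_normD _ _) _.
have := ler_normB (A - y%:R * P) (C - (y %/ p)%N%:R * P).
have : `|r * P| <= 1 :> R.
  case/andP: P01 => P0 P1; rewrite ger0_norm; first exact: mulr_ile1.
  exact: mulr_ge0.
by rewrite exprS; lra.
Qed.

Lemma totient_prod (R : numFieldType) (n : nat) : (0 < n)%N ->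
  (totient n)%:R = n%:R * \prod_(p <- primes n) (1 - p%:R^-1) :> R.
Proof.
move=> n_gt0; rewrite totientE // [X in _ = X%:R * _](prod_prime_decomp n_gt0) prime_decompE.
rewrite big_map /= !natr_prod -big_split /= big_seq [RHS]big_seq.
apply: eq_bigr => p p_n; have p_pr : prime p by move: p_n; rewrite mem_primes => /andP[].
have p_gt0 := prime_gt0 p_pr.
rewrite /pfactor /=; have : (0 < logn p n)%N by rewrite logn_gt0.
case: (logn p n) => // e _; rewrite natrM /= expnS natrM -subn1 natrB //.
have : p%:R != 0 :> R by rewrite pnatr_eq0 -lt0n.
by move=> p0; field.
Qed.

Lemma coprime_all_primes (a n : nat) : (0 < n)%N ->
  coprime a n = all (fun p => ~~ (p %| a)%N) (primes n).
Proof.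
move=> n_gt0; have [->|a_gt0] := posnP a.
  rewrite /coprime gcd0n; have [n1|n1] := leqP n 1.
    by have -> : n = 1%N by apply/eqP; rewrite eqn_leq n1 n_gt0.
  rewrite gtn_eqF //; apply/esym/negbTE/allPn; exists (pdiv n); last by rewrite dvdn0.
  by rewrite mem_primes pdiv_prime // n_gt0 pdiv_dvd.
rewrite coprime_has_primes // -all_predC; apply: eq_in_all => p p_n /=.
by rewrite mem_primes a_gt0 /=; move: p_n; rewrite mem_primes => /andP[->].
Qed.

(** At most [k] primes lie below [k], and each prime factor that is at least [k] pays for its own
    factor [k] out of [n]. As [k] is free, this encodes omega(n) = o(log n). *)
Lemma expn_size_primes (k n : nat) : (0 < k)%N -> (0 < n)%N ->
  (k ^ size (primes n) <= k ^ k * n)%N.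
Proof.
move=> k_gt0 n_gt0; pose s := primes n.
have -> : size s = (size [seq p <- s | (p < k)%N]
                    + size [seq p <- s | ~~ (p < k)%N])%N.
  by rewrite !size_filter count_predC.
rewrite expnD leq_mul //.
  apply: leq_pexp2l => //; rewrite -[leqRHS](size_iota 0 k).
  apply: uniq_leq_size; first by rewrite filter_uniq // primes_uniq.
  by move=> p; rewrite mem_filter mem_iota add0n leq0n /= => /andP[].
rewrite [leqRHS](prod_prime_decomp n_gt0) prime_decompE big_map /=.
have : all (fun p => (0 < p) && (0 < logn p n))%N s.
  apply/allP => p p_n; rewrite logn_gt0 p_n andbT.
  by move: p_n; rewrite mem_primes => /andP[/prime_gt0].
rewrite -/s; elim: s => [|p s IHs] /=; first by rewrite big_nil.
move=> /andP[/andP[p_gt0 e_gt0] /IHs{}IHs]; rewrite big_cons /pfactor /=.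
case: ltnP => [_|kp] /=; first by rewrite -[leqLHS]mul1n leq_mul // expn_gt0 p_gt0.
rewrite expnS leq_mul // (leq_trans kp) // -{1}(expn1 p).
by apply: leq_pexp2l.
Qed.

(** Take [k = 2 ^ 16] in [expn_size_primes]: the square of the left side is at most
    [K ^ 2 * k ^ k * m], hence at most [m ^ 2] once [m] exceeds [K ^ 2 * k ^ k]. *)
Lemma omega_small (K : nat) : exists m0 : nat, forall m : nat, (m0 <= m)%N ->
  (K * (2 ^ size (primes m)) ^ 8 <= m)%N.
Proof.
pose k := (2 ^ 16)%N; have k_gt0 : (0 < k)%N by rewrite expn_gt0.
move: (erefl k); rewrite {2}/k; move: k k_gt0 => k k_gt0 kE.
exists (K ^ 2 * k ^ k).+1%N => m m_ge.
have m_gt0 : (0 < m)%N by apply: leq_ltn_trans m_ge.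
have := expn_size_primes k_gt0 m_gt0; rewrite {1}kE -expnM => H.
rewrite -leq_sqr expnMn -expnM -expnM.
have -> : (size (primes m) * (8 * 2) = 16 * size (primes m))%N by rewrite mulnC.
apply: leq_trans (leq_mul (leqnn _) H) _.
by rewrite mulnA -mulnn leq_mul // ltnW.
Qed.

Lemma prime_factor_ge_half (R : realFieldType) (p : nat) : (1 < p)%N ->
  2^-1 <= 1 - p%:R^-1 :> R.
Proof.
move=> p_gt1; have : p%:R^-1 <= 2^-1 :> R.
  by rewrite lef_pV2 ?posrE ?ltr0n ?ler_nat // ltnW.
lra.
Qed.

Lemma primes_prod_ge0 (R : realFieldType) (n : nat) :
  (0 <= \prod_(p <- primes n) (1 - p%:R^-1) :> R) &&
  (\prod_(p <- primes n) (1 - p%:R^-1) <= 1 :> R).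
Proof.
rewrite big_seq; apply: (big_ind (fun v : R => 0 <= v <= 1)).
- by rewrite ler01 lexx.
- by move=> u v /andP[u0 u1] /andP[v0 v1]; rewrite mulr_ge0 //= mulr_ile1.
- move=> q; rewrite mem_primes => /andP[/prime_gt0 q0 _].
  by rewrite subr_ge0 invf_le1 ?ltr0n // ler1n q0 lerBlDr lerDl invr_ge0 ler0n.
Qed.

(** Every factor [1 - 1/p] of [totient n / n] is at least 1/2. *)
Lemma totient_lower (n : nat) : (n <= totient n * 2 ^ size (primes n))%N.
Proof.
have [->//|n_gt0] := posnP n.
rewrite -(ler_nat rat) natrM totient_prod // -mulrA ler_peMr ?ler0n //.
have : all (ltn 1) (primes n).
  by apply/allP => p; rewrite mem_primes => /andP[/prime_gt1].
elim: (primes n) => [|p s IH] /=; first by rewrite big_nil.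
move=> /andP[p1 /IH{}IH]; rewrite big_cons expnS natrM mulrACA.
rewrite mulr_ege1 //; have := prime_factor_ge_half rat p1; lra.
Qed.

Lemma coprime_sieve_count (R : realFieldType) (n y : nat) : (0 < n)%N ->
  `|\sum_(1 <= a < y.+1 | coprime a n) 1
     - y%:R * ((totient n)%:R / n%:R)| <= 2 ^+ size (primes n) :> R.
Proof.
move=> n_gt0.
rewrite totient_prod // [X in y%:R * X]mulrC mulKf ?pnatr_eq0 -?lt0n //.
have /(@sieve_count R)/(_ (primes_uniq n)) : all prime (primes n).
  by apply/allP => p; rewrite mem_primes => /andP[].
move=> /(_ y) /le_trans H.
have -> : \sum_(1 <= a < y.+1 | coprime a n) (1 : R) =
    \sum_(1 <= a < y.+1 | all (fun p => ~~ (p %| a)%N) (primes n)) 1.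
  by apply: eq_bigl => a; exact: coprime_all_primes.
by apply: H; rewrite lerBlDr lerDl.
Qed.

(** Difference of the sieve counts up to [n * v] and up to [n * u]: two sieve errors and one unit of
    rounding make the 3. The ends may lie outside [0, 1]: [truncn] is 0 on negative numbers, and the
    cut at [a <= n] only lowers the count. *)
Lemma coprime_count_upper (R : realType) (n : nat) (u v : R) : (0 < n)%N -> u <= v ->
  \sum_(1 <= a < n.+1 | coprime a n && (u < a%:R / n%:R < v)) 1 <=
  (totient n)%:R * (v - u) + 3 * 2 ^+ size (primes n).
Proof.
move=> n_gt0 uv; pose x := Num.truncn (n%:R * u); pose y := Num.truncn (n%:R * v).
have nR : 0 < n%:R :> R by rewrite ltr0n.
have xy : (x <= y)%N by rewrite le_truncn // ler_wpM2l // ltW.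
pose N := maxn n y.
have Hy := coprime_sieve_count R y n_gt0; have Hx := coprime_sieve_count R x n_gt0.
have sum_le : \sum_(1 <= a < n.+1 | coprime a n && (u < a%:R / n%:R < v)) (1 : R)
   + \sum_(1 <= a < x.+1 | coprime a n) 1 <= \sum_(1 <= a < y.+1 | coprime a n) 1.
  rewrite (@big_nat_widen _ _ _ _ n.+1 N.+1) ?ltnS ?leq_maxl //.
  rewrite (@big_nat_widen _ _ _ _ x.+1 N.+1) ?ltnS ?(leq_trans xy) ?leq_maxr //.
  rewrite (@big_nat_widen _ _ _ _ y.+1 N.+1) ?ltnS ?leq_maxr //.
  rewrite big_mkcond [X in _ + X]big_mkcond [leRHS]big_mkcond -big_split /= big_nat_cond.
  rewrite [leRHS]big_nat_cond; apply: ler_sum => a /andP[/andP[a_gt0 _] _].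
  rewrite !ltnS; case: (coprime a n) => /=; last by rewrite addr0.
  have [ax|xa] := leqP a x.
    have -> : (u < a%:R / n%:R) = false.
      apply/negbTE; rewrite -leNgt ler_pdivrMr // mulrC.
      by rewrite -(prednK a_gt0) -truncn_gt_nat prednK.
    by rewrite /= (leq_trans ax xy) add0r.
  rewrite addr0; case: ifP => [/andP[/andP[_ av] _]|_]; last by case: ifP.
  suff -> : (a <= y)%N by [].
  rewrite -(prednK a_gt0) truncn_gt_nat prednK //.
  by move: av; rewrite ltr_pdivrMr // mulrC => /ltW.
have xu : n%:R * u < x%:R + 1 by rewrite natr1; exact: truncnS_gt.
have yv : y%:R - x%:R <= n%:R * (v - u) + 1.
  have [v0|v0] := leP 0 (n%:R * v).
    by have : y%:R <= n%:R * v by [rewrite truncn_le]; rewrite mulrBr; lra.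
  have -> : y = 0%N by apply/eqP; rewrite -leqn0 truncn_le_nat (lt_trans v0).
  have : 0 <= n%:R * (v - u) by rewrite mulr_ge0 ?subr_ge0 // ltW.
  by have := ler0n R x; lra.
have [c0 c1] : 0 <= (totient n)%:R / n%:R :> R /\ (totient n)%:R / n%:R <= 1 :> R.
  rewrite totient_prod // mulrC mulKf ?gt_eqF //.
  by have /andP := primes_prod_ge0 R n.
have w1 : 1 <= 2 ^+ size (primes n) :> R by rewrite exprn_ege1 // ler1n.
move: Hx Hy; rewrite !ler_norml => /andP[Hx _] /andP[_ Hy].
have -> : (totient n)%:R * (v - u) = n%:R * (v - u) * ((totient n)%:R / n%:R).
  by field; rewrite gt_eqF.
have := ler_wpM2r c0 yv; rewrite mulrBl mulrDl mul1r; lra.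
Qed.

(** Here [v <= 1] keeps the cut at [a <= n] from losing fractions, and [0 <= u] makes [truncn] a
    true lower bound of [n * u]. *)
Lemma coprime_count_lower (R : realType) (n : nat) (u v : R) : (0 < n)%N ->
  0 <= u -> u <= v -> v <= 1 ->
  (totient n)%:R * (v - u) - 3 * 2 ^+ size (primes n) <=
  \sum_(1 <= a < n.+1 | coprime a n && (u < a%:R / n%:R <= v)) 1.
Proof.
move=> n_gt0 u0 uv v1.
pose x := Num.truncn (n%:R * u); pose y := Num.truncn (n%:R * v).
have nR : 0 < n%:R :> R by rewrite ltr0n.
have xy : (x <= y)%N by rewrite le_truncn // ler_wpM2l // ltW.
have yn : (y <= n)%N by rewrite -[leqRHS](@natrK R) le_truncn // ger_pMr.
have Hy := coprime_sieve_count R y n_gt0; have Hx := coprime_sieve_count R x n_gt0.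
have sum_le : \sum_(1 <= a < y.+1 | coprime a n) (1 : R) <=
    \sum_(1 <= a < n.+1 | coprime a n && (u < a%:R / n%:R <= v)) 1
   + \sum_(1 <= a < x.+1 | coprime a n) 1.
  rewrite (@big_nat_widen _ _ _ _ x.+1 n.+1) ?ltnS ?(leq_trans xy) //.
  rewrite (@big_nat_widen _ _ _ _ y.+1 n.+1) ?ltnS //.
  rewrite big_mkcond [leRHS]addrC [X in X + _]big_mkcond.
  rewrite [X in _ + X]big_mkcond -big_split /= big_nat_cond.
  rewrite [leRHS]big_nat_cond; apply: ler_sum => a /andP[/andP[a_gt0 _] _].
  rewrite !ltnS; case: (coprime a n) => /=; last by rewrite addr0.
  have [ax|xa] := leqP a x; first by rewrite (leq_trans ax xy); case: ifP => //; lra.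
  rewrite add0r; have [ay|ya] := leqP a y; last by case: ifP.
  rewrite ltr_pdivlMr // mulrC (lt_le_trans (truncnS_gt _)) ?ler_nat //=.
  rewrite ler_pdivrMr // [v * _]mulrC -(prednK a_gt0) -truncn_gt_nat prednK //.
  by rewrite ay.
have xu : x%:R <= n%:R * u by rewrite truncn_le mulr_ge0 // ltW.
have yv : n%:R * (v - u) - 1 <= y%:R - x%:R.
  have : n%:R * v < y%:R + 1 by rewrite natr1; exact: truncnS_gt.
  by rewrite mulrBr; lra.
have [c0 c1] : 0 <= (totient n)%:R / n%:R :> R /\ (totient n)%:R / n%:R <= 1 :> R.
  rewrite totient_prod // mulrC mulKf ?gt_eqF //.
  by have /andP := primes_prod_ge0 R n.
have w1 : 1 <= 2 ^+ size (primes n) :> R by rewrite exprn_ege1 // ler1n.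
move: Hx Hy; rewrite !ler_norml => /andP[_ Hx] /andP[Hy _].
have -> : (totient n)%:R * (v - u) = n%:R * (v - u) * ((totient n)%:R / n%:R).
  by field; rewrite gt_eqF.
have := ler_wpM2r c0 yv; rewrite !mulrBl mul1r; lra.
Qed.

(** * Primes dividing an integer *)

Lemma coprime_prod_primes (p : nat) (s : seq nat) :
  prime p -> all prime s -> p \notin s -> coprime p (\prod_(q <- s) q).
Proof.
move=> p_pr; elim: s => [|q s IH] /=; first by rewrite big_nil coprimen1.
move=> /andP[q_pr s_pr]; rewrite inE negb_or => /andP[pq ps].
by rewrite big_cons coprimeMr IH // andbT prime_coprime // dvdn_prime2.
Qed.

Lemma dvdn_prod_primes (s : seq nat) (N : nat) : uniq s -> all prime s ->
  all (dvdn^~ N) s -> (\prod_(q <- s) q %| N)%N.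
Proof.
elim: s => [|q s IH] /=; first by rewrite big_nil dvd1n.
move=> /andP[qs s_u] /andP[q_pr s_pr] /andP[qN sN]; rewrite big_cons Gauss_dvd.
  by rewrite qN IH.
exact: coprime_prod_primes.
Qed.

(** Chebyshev's argument: with [Y = 2 ^ i], the primes in ]Y, 2Y] all divide the binomial
    coefficient ['C(Y + Y, Y)], which is at most [2 ^ (Y + Y)], while their product is at least [Y]
    to the number of them. *)
Lemma primes_dyadic_count (i : nat) :
  (i * count prime (index_iota (2 ^ i).+1 (2 ^ i.+1).+1) <= 2 ^ i.+1)%N.
Proof.
pose s := [seq p <- index_iota (2 ^ i).+1 (2 ^ i.+1).+1 | prime p].
rewrite -size_filter -/s; pose Y := (2 ^ i)%N.
have YY : (2 ^ i.+1 = Y + Y)%N by rewrite expnS mul2n addnn.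
have s_dvd : (\prod_(q <- s) q %| 'C(Y + Y, Y))%N.
  apply: dvdn_prod_primes; rewrite ?filter_uniq ?iota_uniq ?filter_all //.
  apply/allP => p; rewrite mem_filter mem_index_iota YY => /andP[p_pr /andP[Yp pY]].
  have : (p %| (Y + Y)`!)%N by rewrite dvdn_fact // prime_gt0.
  rewrite -(bin_fact (leq_addr Y Y)) addKn !Euclid_dvdM // orbb.
  case/orP => // p_Y; exfalso.
  have : forall j, (j <= Y)%N -> ~~ (p %| j`!)%N.
    elim=> [|j IHj] jY; first by rewrite fact0 gtnNdvd // prime_gt1.
    rewrite factS Euclid_dvdM // negb_or IHj ?(ltnW jY) // andbT.
    by rewrite gtnNdvd // (leq_ltn_trans jY).
  by move=> /(_ Y (leqnn Y)); rewrite p_Y.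
have bin_le : ('C(Y + Y, Y) <= 2 ^ (Y + Y))%N.
  rewrite -[2%N]/(1 + 1)%N expnDn.
  have YYY : (Y < (Y + Y).+1)%N by rewrite ltnS leq_addr.
  rewrite (bigD1 (Ordinal YYY)) //= !exp1n !muln1; exact: leq_addr.
have : (2 ^ (i * size s) <= \prod_(q <- s) q)%N.
  rewrite expnM -/Y.
  have : all (fun q => Y < q)%N s.
    by apply/allP => q; rewrite mem_filter mem_index_iota => /andP[_ /andP[]].
  elim: (s) => [|q t IH] /=; first by rewrite big_nil.
  by move=> /andP[Yq /IH{}IH]; rewrite big_cons expnS leq_mul // ltnW.
move/leq_trans => /(_ _ (dvdn_leq _ s_dvd)); rewrite bin_gt0 leq_addr => /(_ isT).
move/leq_trans => /(_ _ bin_le); rewrite leq_exp2l // YY //.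
Qed.

(** For [i >= k], the block from [2 ^ i] to [2 ^ i.+1] contributes at most [2 / i], hence at most
    [2 / k], by [primes_dyadic_count]. *)
Lemma sum_primes_dyadic (R : realFieldType) (k j : nat) : (0 < k)%N ->
  \sum_((2 ^ k).+1 <= p < (2 ^ (k + j)).+1 | prime p) p%:R^-1 <= 2 * j%:R / k%:R :> R.
Proof.
move=> k_gt0; elim: j => [|j IHj]; first by rewrite addn0 big_geq // mulr0 mul0r.
rewrite (@big_cat_nat _ _ _ (2 ^ (k + j)).+1) /= ?ltnS ?leq_exp2l ?leq_addr //; last first.
  by rewrite leq_add2l.
have -> : 2 * j.+1%:R / k%:R = 2 * j%:R / k%:R + 2 / k%:R :> R.
  by rewrite -natr1; field; rewrite pnatr_eq0 -lt0n.
apply: lerD IHj _; rewrite addnS.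
have Y0 : 0 < (2 ^ (k + j))%:R :> R by rewrite ltr0n expn_gt0.
apply: le_trans (_ : \sum_((2 ^ (k + j)).+1 <= p < (2 ^ (k + j).+1).+1 | prime p)
    (2 ^ (k + j))%:R^-1 <= _).
  rewrite big_nat_cond [leRHS]big_nat_cond; apply: ler_sum => p /andP[/andP[Yp _] _].
  rewrite lef_pV2 ?posrE ?ltr0n ?ler_nat ?expn_gt0 //; first exact: ltnW.
  exact: leq_ltn_trans Yp.
rewrite big_const_seq iter_addr_0 -[_ *+ _]mulr_natl.
rewrite ler_pdivrMr // mulrAC ler_pdivlMr ?ltr0n // -natrM.
apply: le_trans (_ : ((k + j) * count prime
   (index_iota (2 ^ (k + j)).+1 (2 ^ (k + j).+1).+1))%:R <= _).
  by rewrite ler_nat mulnC leq_mul // leq_addr.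
by rewrite -natrM ler_nat -expnS primes_dyadic_count.
Qed.

Lemma ler_sum_subset (R : numDomainType) (I : eqType) (s t : seq I) (F : I -> R) :
  uniq s -> uniq t -> {subset s <= t} -> (forall i, 0 <= F i) ->
  \sum_(i <- s) F i <= \sum_(i <- t) F i.
Proof.
move=> s_u t_u st F0.
have E : \sum_(i <- t | i \in s) F i = \sum_(i <- s) F i.
  rewrite -big_filter; apply: perm_big; apply: uniq_perm; rewrite ?filter_uniq // => i.
  by rewrite mem_filter; case: (boolP (i \in s)) => // /st ->.
by rewrite -E [leRHS](bigID (mem s)) /= lerDl sumr_ge0.
Qed.

Lemma expn2_size_primes (n : nat) : (0 < n)%N -> (2 ^ size (primes n) <= n)%N.
Proof.
move=> n_gt0; have : (\prod_(q <- primes n) q %| n)%N.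
  apply: dvdn_prod_primes; rewrite ?primes_uniq //.
    by apply/allP => p; rewrite mem_primes => /andP[].
  by apply/allP => p; rewrite mem_primes => /and3P[].
move/dvdn_leq => /(_ n_gt0); apply: leq_trans.
have : all (fun q => 1 < q)%N (primes n).
  by apply/allP => q; rewrite mem_primes => /andP[/prime_gt1].
elim: (primes n) => [|q t IH] /=; first by rewrite big_nil.
by move=> /andP[q1 /IH{}IH]; rewrite big_cons expnS leq_mul.
Qed.

(** The primes from [2 ^ k] to [2 ^ (2 * k)] fill [k] dyadic blocks and contribute at most 2. Those
    beyond [4 ^ k] number at most log2(n), which is below [4 ^ k.+1], so they contribute at most
    4. *)
Lemma sum_large_primes (R : realFieldType) (k n : nat) : (0 < k)%N -> (0 < n)%N ->
  (n < 2 ^ (4 ^ k.+1))%N ->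
  \sum_(p <- primes n | (2 ^ k < p)%N) p%:R^-1 <= 6 :> R.
Proof.
move=> k_gt0 n_gt0 n_lt; rewrite (bigID (fun p => p <= 2 ^ (k + k))%N) /=.
have -> : 6 = 2 * k%:R / k%:R + 4 :> R by rewrite mulfK ?pnatr_eq0 -?lt0n //; ring.
apply: lerD.
  apply: le_trans (sum_primes_dyadic _ _ k_gt0).
  rewrite -big_filter -[leRHS]big_filter; apply: ler_sum_subset.
  - by rewrite filter_uniq // primes_uniq.
  - by rewrite filter_uniq // iota_uniq.
  - move=> p; rewrite !mem_filter mem_index_iota mem_primes !ltnS.
    by case/andP=> /andP[-> ->] /andP[->].
  - by move=> p; rewrite invr_ge0.
apply: le_trans (_ : \sum_(p <- primes n) (4 ^ k)%:R^-1 <= _).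
  rewrite big_mkcond; apply: ler_sum => p _; case: ifP => [|_]; last by rewrite invr_ge0.
  rewrite -ltnNge addnn -mul2n expnM => /andP[_ pk].
  rewrite lef_pV2 ?posrE ?ltr0n ?expn_gt0 ?ler_nat ?(ltnW pk) //.
  exact: leq_ltn_trans pk.
rewrite big_const_seq iter_addr_0 count_predT -[_ *+ _]mulr_natl.
rewrite ler_pdivrMr ?ltr0n ?expn_gt0 // -natrM ler_nat -expnS ltnW //.
by rewrite -(@ltn_exp2l 2) // (leq_ltn_trans (expn2_size_primes n_gt0)).
Qed.

(** For [0 <= x <= 1/2] one has [expR (2 * x) * (1 - x) >= (1 + 2 * x) * (1 - x) >= 1]; multiplying
    over [x = 1/p], the bound 6 of [sum_large_primes] doubles to 12. *)
Lemma prod_large_primes (R : realType) (k n : nat) : (0 < k)%N -> (0 < n)%N ->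
  (n < 2 ^ (4 ^ k.+1))%N ->
  1 <= expR 12 * \prod_(p <- primes n | (2 ^ k < p)%N) (1 - p%:R^-1) :> R.
Proof.
move=> k_gt0 n_gt0 n_lt; have H := sum_large_primes R k_gt0 n_gt0 n_lt.
set S := \sum_(_ <- _ | _) _ in H; set P := \prod_(_ <- _ | _) _.
have P0 : 0 <= P.
  rewrite /P big_seq_cond; apply: prodr_ge0 => p /andP[]; rewrite mem_primes => /andP[pr _] _.
  by rewrite subr_ge0 invf_le1 ?ler1n ?ltr0n prime_gt0.
have HS : expR (2 * S) <= expR 12 by rewrite ler_expR; lra.
apply: le_trans (ler_wpM2r P0 HS).
rewrite /S /P mulr_sumr expR_sum -big_split /= big_seq_cond.
apply: (big_ind (fun v : R => 1 <= v)) => // [u v|p]; first exact: mulr_ege1.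
rewrite mem_primes => /andP[/andP[/prime_gt1 p1 _] _].
have h : p%:R^-1 <= 2^-1 :> R by rewrite lef_pV2 ?posrE ?ltr0n ?ler_nat // ltnW.
have p0 : 0 <= p%:R^-1 :> R by rewrite invr_ge0.
move: h p0; set x := p%:R^-1 => h p0.
apply: le_trans (_ : (1 + 2 * x) * (1 - x) <= _).
  by nra.
by rewrite ler_wpM2r ?expR_ge1Dx //; lra.
Qed.

(** * Close pairs of reduced fractions *)

(** By the Chinese remainder theorem, [t] below [d * e] is determined by its residues modulo [d] and
    [e]. *)
Lemma count_crt_le (P Q : pred nat) (d e : nat) : coprime d e -> (0 < d)%N -> (0 < e)%N ->
  (forall t, P t = P (t %% d)%N) -> (forall t, Q t = Q (t %% e)%N) ->
  (count (predI P Q) (iota 0 (d * e)) <= count P (iota 0 d) * count Q (iota 0 e))%N.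
Proof.
move=> de d_gt0 e_gt0 PE QE; rewrite -!size_filter -(size_allpairs pair).
rewrite -(size_map (fun t => (t %% d, t %% e)%N)); apply: uniq_leq_size.
  rewrite map_inj_in_uniq ?filter_uniq ?iota_uniq // => s t.
  rewrite !mem_filter !mem_iota /= add0n => /andP[_ s_lt] /andP[_ t_lt] [sd se].
  have : s == t %[mod d * e] by rewrite chinese_remainder // sd se !eqxx.
  by rewrite !modn_small // => /eqP.
move=> _ /mapP[t t_in ->]; move: t_in; rewrite mem_filter /= => /andP[/andP[Pt Qt] _].
by apply: allpairs_f; rewrite mem_filter -?PE -?QE ?Pt ?Qt mem_iota add0n ltn_mod.
Qed.

Lemma count_periodic (P : pred nat) (d l : nat) : (forall t, P (d + t)%N = P t) ->
  count P (iota 0 (d * l)) = (count P (iota 0 d) * l)%N.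
Proof.
move=> PE; have PE' j t : P (d * j + t)%N = P t.
  by elim: j => [|j IH]; [rewrite muln0|rewrite mulnS -addnA PE].
elim: l => [|l IH]; first by rewrite !muln0.
rewrite mulnS addnC iotaD count_cat IH add0n.
have -> : iota (d * l) d = map (addn (d * l)) (iota 0 d) by rewrite -iotaDl addn0.
rewrite count_map.
by rewrite mulnS addnC; congr (_ + _)%N; apply: eq_count => t /=; rewrite PE'.
Qed.

Lemma affine_root (p a k : nat) : (0 < p)%N -> (0 < k)%N -> coprime p k ->
  exists2 t, (t < p)%N & (p %| a + t * k)%N.
Proof.
move=> p_gt0 k_gt0 pk; pose r := (p - a %% p)%N.
(* [x] is congruent to [- a] modulo [p] and to 0 modulo [k], so [x %/ k] solves the congruence. *)
pose x := chinese p k r 0; exists (x %/ k %% p)%N; first by rewrite ltn_mod.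
have xk : (k %| x)%N by rewrite /dvdn chinese_modr // mod0n.
rewrite /dvdn -modnDmr -modnMml modn_mod modnMml divnK // modnDmr -modnDml -modnDmr.
by rewrite chinese_modl // modnDmr subnKC ?modnn // ltnW // ltn_mod.
Qed.

(* The two forbidden residues coincide exactly when [p] divides [c]. *)
Lemma count_two_residues (p a b k l c : nat) : prime p -> (0 < k)%N -> (0 < l)%N ->
  coprime p k -> coprime p l -> (a * l = b * k + c)%N ->
  (count (fun t => ~~ (p %| a + t * k) && ~~ (p %| b + t * l)) (iota 0 p) + 2
   <= p + (p %| c))%N.
Proof.
move=> p_pr k_gt0 l_gt0 pk pl E; have p_gt0 := prime_gt0 p_pr.
have [s s_p ds] := affine_root a p_gt0 k_gt0 pk.
have [t t_p dt] := affine_root b p_gt0 l_gt0 pl.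
set P := (fun _ => _).
rewrite -[X in (_ <= X + _)%N](size_iota 0 p) -(count_predC P (iota 0 p)) -addnA leq_add2l.
have [st|st] := eqVneq s t.
  have -> : (p %| c)%N.
    have E' : ((a + s * k) * l = (b + s * l) * k + c)%N by nia.
    have : (p %| (a + s * k) * l)%N by rewrite dvdn_mulr.
    by rewrite E' dvdn_addr // dvdn_mulr // st.
  rewrite addn1 ltnS -has_count; apply/hasP; exists s; first by rewrite mem_iota.
  by rewrite /= /P ds.
rewrite -size_filter -[2%N]/(size [:: s; t]) -[leqLHS]addn0 leq_add //.
apply: uniq_leq_size; first by rewrite /= inE st.
move=> x; rewrite !inE mem_filter mem_iota /= /P.
by case/orP => /eqP ->; rewrite ?s_p ?t_p ?ds ?dt ?andbF.
Qed.

(** By the Chinese remainder theorem the count is at most the product of the counts modulo each [p],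
    bounded by [p - 2], or [p - 1] if [p] divides [c]. The factor on the right is exactly [p - 1] in
    the second case and [p - 2 + 1/p] in the first. *)
Lemma sieved_progression_count (R : realFieldType) (ps : seq nat) (a b k l c : nat) :
  all prime ps -> uniq ps -> (0 < k)%N -> (0 < l)%N ->
  all (coprime^~ k) ps -> all (coprime^~ l) ps -> (a * l = b * k + c)%N ->
  (count (fun t => all (fun p => ~~ (p %| a + t * k) && ~~ (p %| b + t * l)) ps)%N
     (iota 0 (\prod_(p <- ps) p)))%:R <=
  (\prod_(p <- ps) p)%:R *
  \prod_(p <- ps) ((1 - p%:R^-1) ^+ 2 * (1 + (p %| c)%N%:R / (p%:R - 1))) :> R.
Proof.
move=> + + k_gt0 l_gt0 + + E; elim: ps => [|p ps IH] /=; first by rewrite !big_nil /= mulr1.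
move=> /andP[p_pr ps_pr] /andP[p_ps ps_u] /andP[pk psk] /andP[pl psl].
have {}IH := IH ps_pr ps_u psk psl; rewrite !big_cons.
pose Q t := (~~ (p %| a + t * k) && ~~ (p %| b + t * l))%N.
pose P t := all (fun p => ~~ (p %| a + t * k) && ~~ (p %| b + t * l))%N ps.
rewrite -/P in IH.
have q_gt0 : (0 < \prod_(p <- ps) p)%N.
  by rewrite big_seq; apply: prodn_cond_gt0 => q /(allP ps_pr) /prime_gt0.
have p_gt0 := prime_gt0 p_pr.
have dvd_mod r d x y t : (r %| d)%N -> (r %| x + t %% d * y)%N = (r %| x + t * y)%N.
  move=> rd; rewrite {2}(divn_eq t d) mulnDl addnCA [RHS]dvdn_addr //.
  by rewrite dvdn_mulr // dvdn_mull.
have crt : (count (predI Q P) (iota 0 (p * \prod_(p <- ps) p)) <=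
    count Q (iota 0 p) * count P (iota 0 (\prod_(p <- ps) p)))%N.
  apply: count_crt_le => //; first exact: coprime_prod_primes.
    by move=> t; rewrite /Q !dvd_mod.
  move=> t; apply: eq_in_all => r r_ps; rewrite !dvd_mod //;
    by rewrite (big_rem r) //= dvdn_mulr.
apply: le_trans (_ : (count Q (iota 0 p) *
   count P (iota 0 (\prod_(p <- ps) p)))%:R <= _); first by rewrite ler_nat; exact: crt.
rewrite !natrM mulrACA ler_pM //.
have := count_two_residues p_pr k_gt0 l_gt0 pk pl E; rewrite -/Q.
rewrite -(ler_nat R) !natrD => H.
have p1 : 2 <= p%:R :> R by rewrite ler_nat prime_gt1.
have -> : p%:R * ((1 - p%:R^-1) ^+ 2 * (1 + (p %| c)%N%:R / (p%:R - 1))) =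
   (p%:R - 1) ^+ 2 / p%:R + (p%:R - 1) / p%:R * (p %| c)%N%:R :> R.
  by field; apply/andP; split; apply: lt0r_neq0; lra.
have pV : 0 < p%:R^-1 :> R by rewrite invr_gt0; lra.
have pVp : p%:R * p%:R^-1 = 1 :> R by rewrite mulfV // gt_eqF //; lra.
move: H; case: (p %| c)%N => /=; rewrite ?addr0 ?mulr0 ?mulr1 => H.
  have -> : (p%:R - 1) ^+ 2 / p%:R + (p%:R - 1) / p%:R = p%:R - 1 :> R.
    by field; apply: lt0r_neq0; lra.
  lra.
have -> : (p%:R - 1) ^+ 2 / p%:R = p%:R - 2 + p%:R^-1 :> R.
  by field; apply: lt0r_neq0; lra.
lra.
Qed.

(** Since [k] and [l] are coprime, the solutions of [a * l = b * k + c] form one progression with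
    steps [k] and [l]. The bound [g * k] on the first coordinate leaves [g] values of the parameter,
    which make up whole periods of the sieve because the product of [ps] divides [g]. *)
Lemma fixed_diff_count (R : realFieldType) (ps : seq nat) (g k l c : nat)
    (s : seq (nat * nat)) :
  all prime ps -> uniq ps -> (0 < k)%N -> (0 < l)%N -> coprime k l ->
  all (coprime^~ k) ps -> all (coprime^~ l) ps ->
  (\prod_(p <- ps) p %| g)%N -> uniq s ->
  (forall ab, ab \in s -> [/\ (ab.1 < g * k)%N, (ab.1 * l = ab.2 * k + c)%N &
     all (fun p => ~~ (p %| ab.1) && ~~ (p %| ab.2)) ps])%N ->
  (size s)%:R <= g%:R *
   \prod_(p <- ps) ((1 - p%:R^-1) ^+ 2 * (1 + (p %| c)%N%:R / (p%:R - 1))) :> R.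
Proof.
move=> ps_pr ps_u k_gt0 l_gt0 kl psk psl /dvdnP[h gE] s_u sP.
have prod_ge0 : 0 <= \prod_(p <- ps)
    ((1 - p%:R^-1) ^+ 2 * (1 + (p %| c)%N%:R / (p%:R - 1))) :> R.
  rewrite big_seq; apply: prodr_ge0 => p /(allP ps_pr) /prime_gt1 p1.
  by rewrite mulr_ge0 ?sqr_ge0 // addr_ge0 // divr_ge0 // subr_ge0 ler1n ltnW.
have [->|s_neq0] := eqVneq s [::]; first by rewrite mulr_ge0.
have [ab0 ab0s] : exists x, x \in s.
  by case: (s) s_neq0 => // x s' _; exists x; rewrite mem_head.
have ex_a : exists a, has (fun ab => ab.1 == a) s.
  by exists ab0.1; apply/hasP; exists ab0.
(* The solution with the smallest first coordinate is the origin, so that every other one has a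
   parameter [t] in [nat]. *)
case: (ex_minnP ex_a) => a /hasP[[a' b] ab_s /eqP /= aE] a_min; subst a'.
have [/= a_lt E ab_ps] := sP _ ab_s.
have sol x : x \in s -> exists t, x = (a + t * k, b + t * l)%N.
  move=> xs; have [_ Ex _] := sP _ xs.
  have ax : (a <= x.1)%N by apply: a_min => /=; apply/hasP; exists x => /=.
  have bx : (b * k <= x.2 * k)%N by have := leq_mul ax (leqnn l); lia.
  have Ed : ((x.1 - a) * l = (x.2 - b) * k)%N by rewrite !mulnBl; lia.
  have /dvdnP[t tE] : (k %| x.1 - a)%N.
    by rewrite -(Gauss_dvdl _ kl) Ed dvdn_mull.
  exists t; case: x xs Ex ax bx Ed tE => x y /= _ _ ax bx Ed tE.
  rewrite leq_pmul2r // in bx.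
  have tE' : (y - b = t * l)%N.
    by apply/eqP; rewrite -(eqn_pmul2r k_gt0) -Ed tE -!mulnA [(l * k)%N]mulnC.
  by rewrite -tE -tE' !subnKC.
pose P t := all (fun p => ~~ (p %| a + t * k) && ~~ (p %| b + t * l))%N ps.
have size_le : (size s <= count P (iota 0 g))%N.
  rewrite -(size_map (fun x => (x.1 - a) %/ k)%N) -size_filter.
  apply: uniq_leq_size.
    rewrite map_inj_in_uniq // => x y /sol[t ->] /sol[u ->] /=.
    by rewrite !addKn !mulnK // => ->.
  move=> _ /mapP[x xs ->]; have [t xE] := sol _ xs; have [lt_x _ ps_x] := sP _ xs.
  rewrite xE /= addKn mulnK // mem_filter mem_iota add0n /=; rewrite xE /= in lt_x ps_x.
  by rewrite /P ps_x -(ltn_pmul2r k_gt0) (leq_ltn_trans _ lt_x) // leq_addl.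
apply: le_trans (_ : (count P (iota 0 g))%:R <= _); first by rewrite ler_nat.
rewrite gE mulnC count_periodic; last first.
  move=> t; apply: eq_in_all => p p_ps.
  have pq : (p %| \prod_(p <- ps) p)%N by rewrite (big_rem p) //= dvdn_mulr.
  have shift x y : (p %| x + (\prod_(p <- ps) p + t) * y)%N = (p %| x + t * y)%N.
    by rewrite mulnDl addnCA [LHS]dvdn_addr // dvdn_mulr.
  by rewrite !shift.
rewrite !natrM mulrAC ler_wpM2r //.
exact: sieved_progression_count ps_pr ps_u k_gt0 l_gt0 psk psl E.
Qed.

(** By induction on [ps]: a new prime adds [1 / (p - 1)] times the same sum over the multiples of
    [p], which is a sum up to [N %/ p]. This multiplies the bound by [1 + 1 / (p * (p - 1))]. *)
Lemma sum_prod_prime_divisors (R : realFieldType) (ps : seq nat) (N : nat) :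
  all prime ps -> uniq ps ->
  \sum_(1 <= c < N.+1) \prod_(p <- ps) (1 + (p %| c)%N%:R / (p%:R - 1)) <=
  N%:R * \prod_(p <- ps) (1 + (p%:R * (p%:R - 1))^-1) :> R.
Proof.
elim: ps N => [|p ps IH] N /=.
  move=> _ _; rewrite big_nil mulr1; under eq_bigr do rewrite big_nil.
  by rewrite sumr_const_nat subn1.
move=> /andP[p_pr ps_pr] /andP[p_ps ps_u].
have p_gt0 := prime_gt0 p_pr.
have p1 : 2 <= p%:R :> R by rewrite ler_nat prime_gt1.
pose F c : R := \prod_(q <- ps) (1 + (q %| c)%N%:R / (q%:R - 1)).
have -> : \sum_(1 <= c < N.+1) \prod_(q <- p :: ps) (1 + (q %| c)%N%:R / (q%:R - 1)) =
    \sum_(1 <= c < N.+1) F c + (p%:R - 1)^-1 * \sum_(1 <= c < (N %/ p).+1) F c :> R.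
  have -> : \sum_(1 <= c < (N %/ p).+1) F c = \sum_(1 <= c < (N %/ p).+1) F (p * c)%N.
    apply: eq_bigr => c _; rewrite /F big_seq [RHS]big_seq; apply: eq_bigr => q q_ps.
    have q_pr := allP ps_pr _ q_ps; rewrite Euclid_dvdM // (dvdn_prime2 q_pr p_pr).
    by have /negPf -> : q != p by apply: contraNneq p_ps => <-.
  rewrite -sum_multiples // [X in _ + _ * X]big_mkcond mulr_sumr -big_split; apply: eq_bigr => c _ /=.
  by rewrite big_cons -/(F c); case: (p %| c)%N => /=; ring.
rewrite big_cons; set Q := \prod_(_ <- _) _.
have Q0 : 0 <= Q.
  rewrite /Q big_seq; apply: prodr_ge0 => q /(allP ps_pr) /prime_gt1 q1.
  by rewrite addr_ge0 // invr_ge0 mulr_ge0 // subr_ge0 ler1n ltnW.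
have h0 : 0 <= (p%:R - 1)^-1 :> R by rewrite invr_ge0; lra.
have Np : (N %/ p)%N%:R <= N%:R / p%:R :> R.
  by rewrite ler_pdivlMr ?ltr0n // -natrM ler_nat leq_divM.
have H1 := IH N ps_pr ps_u; have H2 := IH (N %/ p)%N ps_pr ps_u.
apply: le_trans (lerD H1 (ler_wpM2l h0 (le_trans H2 (ler_wpM2r Q0 Np)))) _.
rewrite le_eqVlt; apply/orP; left; apply/eqP.
by rewrite -/Q; field; apply/andP; split; apply: lt0r_neq0; lra.
Qed.

Lemma sum_inv_consecutive (R : realFieldType) (N : nat) :
  \sum_(2 <= j < N.+2) (j%:R * (j%:R - 1))^-1 = 1 - N.+1%:R^-1 :> R.
Proof.
elim: N => [|N IH]; first by rewrite big_geq // invr1 subrr.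
rewrite big_nat_recr //= IH -!natr1.
have := ler0n R N => N0.
by field; apply/andP; split; apply: lt0r_neq0; lra.
Qed.

(** Use [1 + x <= expR x], then bound the sum over the primes by the telescoping sum over all
    integers from 2 on. *)
Lemma prod_primes_le_expR1 (R : realType) (ps : seq nat) :
  all prime ps -> uniq ps ->
  \prod_(p <- ps) (1 + (p%:R * (p%:R - 1))^-1) <= expR 1 :> R.
Proof.
move=> ps_pr ps_u; pose N := (\sum_(p <- ps) p)%N.
have F0 (p : nat) : 0 <= (p%:R * (p%:R - 1))^-1 :> R.
  by case: p => [|p]; rewrite ?mul0r ?invr0 // invr_ge0 mulr_ge0 // subr_ge0 ler1n.
apply: le_trans (_ : expR (\sum_(p <- ps) (p%:R * (p%:R - 1))^-1) <= _).
  rewrite expR_sum; apply: ler_prod => p _.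
  by rewrite expR_ge1Dx addr_ge0.
rewrite ler_expR; apply: le_trans (_ : \sum_(2 <= j < N.+2) (j%:R * (j%:R - 1))^-1 <= _).
  apply: ler_sum_subset => //; first exact: iota_uniq.
  move=> p p_ps; rewrite mem_index_iota prime_gt1 ?(allP ps_pr) //=.
  by rewrite ltnS /N (big_rem p) //= leqW ?leq_addr.
by rewrite sum_inv_consecutive lerBlDr lerDl invr_ge0.
Qed.

Lemma size_le_sum_fibers (T : eqType) (f : T -> nat) (s : seq T) (N : nat) :
  (forall x, x \in s -> (1 <= f x <= N)%N) ->
  (size s <= \sum_(1 <= c < N.+1) size [seq x <- s | f x == c])%N.
Proof.
move=> fP; under eq_bigr do rewrite size_filter -sum1_count big_mkcond.
rewrite exchange_big /= -sum1_size big_seq [leqRHS]big_seq; apply: leq_sum => x xs.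
rewrite (bigD1_seq (f x)) ?iota_uniq ?mem_index_iota ?ltnS ?fP //= eqxx.
by rewrite leq_addr.
Qed.

Lemma small_primes_prod (R : realType) (k n : nat) : (0 < k)%N -> (0 < n)%N ->
  (n < 2 ^ (4 ^ k.+1))%N ->
  \prod_(p <- primes n | (p <= 2 ^ k)%N) (1 - p%:R^-1) <=
  expR 12 * ((totient n)%:R / n%:R) :> R.
Proof.
move=> k_gt0 n_gt0 n_lt; have H := prod_large_primes R k_gt0 n_gt0 n_lt.
rewrite totient_prod // [_ * \prod_(_ <- _) _]mulrC mulfK ?pnatr_eq0 -?lt0n //.
rewrite [X in _ <= _ * X](bigID (fun p => p <= 2 ^ k)%N) /= mulrCA ler_peMr //.
  rewrite big_seq_cond; apply: prodr_ge0 => p /andP[]; rewrite mem_primes => /andP[pr _] _.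
  by rewrite subr_ge0 invf_le1 ?ler1n ?ltr0n prime_gt0.
by under eq_bigl do rewrite -ltnNge.
Qed.

(** Write [m = g * m'], [n = g * n'] with [g] the gcd. Then [c = a * n' - b * m'] runs over 1, ...,
    [T / g], and [fixed_diff_count] bounds the pairs for each [c], sieving by the primes of [m] up
    to [2 ^ k]. On average over [c] the correction for [p] dividing [c] costs [expR 1]; replacing
    the two products over small primes by [totient m / m] and [totient n / n] costs [expR 12] each,
    whence 25. *)
Lemma close_pairs_count (R : realType) (k m n : nat) (T : R) (s : seq (nat * nat)) :
  (0 < k)%N -> (0 < m < 2 ^ (4 ^ k.+1))%N -> (0 < n < 2 ^ (4 ^ k.+1))%N ->
  (forall p, (p <= 2 ^ k)%N -> logn p m = logn p n) -> 0 <= T -> uniq s ->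
  (forall ab, ab \in s ->
     [/\ (ab.1 < m)%N, coprime ab.1 m, coprime ab.2 n, (ab.2 * m < ab.1 * n)%N &
      (ab.1 * n)%:R - (ab.2 * m)%:R < T]) ->
  (size s)%:R <= expR 25 * T * ((totient m)%:R / m%:R) * ((totient n)%:R / n%:R).
Proof.
move=> k_gt0 /andP[m_gt0 m_lt] /andP[n_gt0 n_lt] val_eq T0 s_u sP.
pose g := gcdn m n; have g_gt0 : (0 < g)%N by rewrite gcdn_gt0 m_gt0.
pose m' := (m %/ g)%N; pose n' := (n %/ g)%N.
have mE : m = (g * m')%N by rewrite mulnC divnK // dvdn_gcdl.
have nE : n = (g * n')%N by rewrite mulnC divnK // dvdn_gcdr.
have m'_gt0 : (0 < m')%N by move: m_gt0; rewrite {1}mE muln_gt0 => /andP[].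
have n'_gt0 : (0 < n')%N by move: n_gt0; rewrite {1}nE muln_gt0 => /andP[].
have mn' : coprime m' n'.
  by rewrite /coprime -(eqn_pmul2l g_gt0) muln1 muln_gcdr -mE -nE.
pose ps := [seq p <- primes m | (p <= 2 ^ k)%N].
have ps_eq : perm_eq ps [seq p <- primes n | (p <= 2 ^ k)%N].
  apply: uniq_perm; rewrite ?filter_uniq ?primes_uniq // => p.
  rewrite !mem_filter; case: leqP => //= p_le.
  by rewrite -!logn_gt0 val_eq.
have ps_pr : all prime ps.
  by apply/allP => p; rewrite mem_filter mem_primes => /and3P[].
have ps_u : uniq ps by rewrite filter_uniq // primes_uniq.
have psP p : p \in ps -> [/\ prime p, (p %| m)%N, (p %| n)%N, coprime p m' & coprime p n'].
  move=> p_ps; have := p_ps; rewrite (perm_mem ps_eq).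
  rewrite mem_filter mem_primes => /andP[_ /and3P[_ _ pn]].
  move: p_ps; rewrite mem_filter mem_primes => /andP[p_le /and3P[p_pr _ pm]].
  have vE : logn p m' = logn p n'.
    by apply/eqP; rewrite -(eqn_add2l (logn p g)) -!lognM // -mE -nE val_eq.
  (* Coprime numbers with equal valuations at [p] are both prime to [p]. *)
  have pm' : ~~ (p %| m')%N.
    apply/negP => pm'; have pn' : (p %| n')%N.
      have : (0 < logn p m')%N by rewrite logn_gt0 mem_primes p_pr m'_gt0.
      by rewrite vE logn_gt0 mem_primes => /and3P[].
    have : (p %| gcdn m' n')%N by rewrite dvdn_gcd pm'.
    by rewrite (eqP mn') dvdn1 => /eqP p1; move: p_pr; rewrite p1.
  split=> //; rewrite prime_coprime //.
  apply: contra pm' => pn'.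
  have : (0 < logn p n')%N by rewrite logn_gt0 mem_primes p_pr n'_gt0.
  by rewrite -vE logn_gt0 mem_primes => /and3P[].
pose f (ab : nat * nat) := (ab.1 * n' - ab.2 * m')%N.
have gR : 0 < g%:R :> R by rewrite ltr0n.
pose N := Num.truncn (T / g%:R).
have lt_f ab : ab \in s -> (ab.2 * m' < ab.1 * n')%N.
  move=> /sP[_ _ _ + _]; rewrite {1}mE {1}nE => H.
  by rewrite -(ltn_pmul2l g_gt0); lia.
have f_le ab : ab \in s -> (1 <= f ab <= N)%N.
  move=> ab_s; have lt_ab := lt_f _ ab_s; have [_ _ _ _ ltT] := sP _ ab_s.
  have f_gt0 : (0 < f ab)%N by rewrite subn_gt0.
  rewrite f_gt0 /= -(prednK f_gt0) truncn_gt_nat prednK //.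
  rewrite ler_pdivlMr // natrB ?(ltnW lt_ab) //.
  apply: le_trans (ltW ltT); rewrite le_eqVlt; apply/orP; left; apply/eqP.
  have -> : (ab.1 * n = g * (ab.1 * n'))%N by rewrite mulnCA -nE.
  have -> : (ab.2 * m = g * (ab.2 * m'))%N by rewrite mulnCA -mE.
  by rewrite !natrM; ring.
have := size_le_sum_fibers f_le; rewrite -(ler_nat R) => /le_trans; apply.
rewrite natr_sum.
pose A : R := \prod_(p <- ps) (1 - p%:R^-1).
pose B c : R := \prod_(p <- ps) (1 + (p %| c)%N%:R / (p%:R - 1)).
have A0 : 0 <= A.
  rewrite /A big_seq; apply: prodr_ge0 => q /(allP ps_pr) /prime_gt0 q0.
  by rewrite subr_ge0 invf_le1 ?ltr0n // ler1n.
apply: le_trans (_ : \sum_(1 <= c < N.+1) g%:R * (A ^+ 2 * B c) <= _).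
  apply: ler_sum => c _; rewrite /A /B -prodrXl -big_split.
  apply: (@fixed_diff_count R ps g m' n' c) => //.
  - by apply/allP => p /psP[].
  - by apply/allP => p /psP[].
  - apply: dvdn_prod_primes => //; apply/allP => p /psP[_ pm pn _ _].
    by rewrite /= dvdn_gcd pm.
  - by rewrite filter_uniq.
  move=> ab; rewrite mem_filter => /andP[/eqP fc ab_s].
  have lt_ab := lt_f _ ab_s; have [a_lt am bn _ _] := sP _ ab_s; split.
  - by rewrite -mE.
  - by rewrite -fc /f subnKC // ltnW.
  - apply/allP => p /psP[p_pr pm pn _ _]; apply/andP; split; apply/negP => pd.
      have : (p %| gcdn ab.1 m)%N by rewrite dvdn_gcd pd.
      by rewrite (eqP am) dvdn1 => /eqP p1; move: p_pr; rewrite p1.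
    have : (p %| gcdn ab.2 n)%N by rewrite dvdn_gcd pd.
    by rewrite (eqP bn) dvdn1 => /eqP p1; move: p_pr; rewrite p1.
rewrite -mulr_sumr -mulr_sumr.
have NT : g%:R * N%:R <= T by rewrite mulrC -ler_pdivlMr // truncn_le divr_ge0 // ltW.
have HB : \sum_(1 <= c < N.+1) B c <= N%:R * expR 1.
  apply: le_trans (sum_prod_prime_divisors R N ps_pr ps_u) _.
  by rewrite ler_wpM2l // prod_primes_le_expR1.
have Am : A <= expR 12 * ((totient m)%:R / m%:R).
  by rewrite /A big_filter; exact: small_primes_prod.
have An : A <= expR 12 * ((totient n)%:R / n%:R).
  by rewrite /A (perm_big _ ps_eq) big_filter; exact: small_primes_prod.
have -> : expR 25 = expR 12 * expR 12 * expR 1 :> R.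
  by rewrite -!expRD; congr expR; ring.
have AA : A ^+ 2 <= (expR 12 * ((totient m)%:R / m%:R)) * (expR 12 * ((totient n)%:R / n%:R)).
  by rewrite expr2 ler_pM.
apply: le_trans (_ : g%:R * (A ^+ 2 * (N%:R * expR 1)) <= _).
  by rewrite ler_wpM2l // ler_wpM2l // sqr_ge0.
rewrite [leLHS](_ : _ = (g%:R * N%:R) * A ^+ 2 * expR 1); last by ring.
apply: le_trans (_ : T * ((expR 12 * ((totient m)%:R / m%:R)) *
   (expR 12 * ((totient n)%:R / n%:R))) * expR 1 <= _); last first.
  by rewrite le_eqVlt; apply/orP; left; apply/eqP; ring.
by rewrite ler_wpM2r ?expR_ge0 // ler_pM ?sqr_ge0 // mulr_ge0.
Qed.

(** * The second moment method *)

(** With [N] the number of [J i] through [x], this is [2 * t * N <= 1 + (t * N) ^ 2] at points of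
    [G] in the union. Off [G] the left side vanishes, and off the union [N = 0]. *)
Lemma second_moment_pointwise (T : Type) (R : realType) (I : Type) (s : seq I)
    (J : I -> set T) (G : set T) (t : R) (x : T) :
  \sum_(i <- s) 2 * t * \1_(G `&` J i) x <=
  \1_(G `&` \big[setU/set0]_(i <- s) J i) x
  + \sum_(i <- s) \sum_(j <- s) t ^+ 2 * \1_(J i `&` J j) x.
Proof.
pose N : R := \sum_(i <- s) \1_(J i) x.
have -> : \sum_(i <- s) \sum_(j <- s) t ^+ 2 * \1_(J i `&` J j) x = (t * N) ^+ 2.
  rewrite exprMn [N ^+ 2]expr2 {1}/N mulr_suml mulr_sumr; apply: eq_bigr => i _.
  by rewrite !mulr_sumr; apply: eq_bigr => j _; rewrite indicI.
have -> : \sum_(i <- s) 2 * t * \1_(G `&` J i) x = 2 * (t * N) * \1_G x.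
  rewrite /N !mulr_sumr mulr_suml; apply: eq_bigr => i _; rewrite indicI /=; ring.
have [Gx|Gx] := boolP (x \in G); last first.
  by rewrite [\1_G x]indicE (negbTE Gx) mulr0 addr_ge0 // sqr_ge0.
have [Ux|Ux] := boolP (x \in \big[setU/set0]_(i <- s) J i).
  rewrite indicI /= !indicE Gx Ux /= mulr1 mulr1.
  have := sqr_ge0 (t * N - 1); rewrite sqrrB1; lra.
have -> : N = 0.
  rewrite /N; elim: s Ux {N} => [|i s IH]; rewrite ?big_nil // !big_cons in_setU negb_or.
  by move=> /andP[xi /IH ->]; rewrite indicE (negbTE xi) addr0.
by rewrite !mulr0 mul0r expr0n addr0.
Qed.

(* Integrating [2 t N <= 1 + t^2 N^2] on [G], with [N] the number of [J i] containing
   a point: the Cauchy-Schwarz bound on the support of [N], without division. *)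
Lemma second_moment (d : measure_display) (T : measurableType d) (R : realType)
    (mu : {measure set T -> \bar R}) (I : Type) (s : seq I) (J : I -> set T)
    (G : set T) (t : R) :
  measurable G -> (forall i, measurable (J i)) -> 0 <= t ->
  (\sum_(i <- s) (2 * t)%:E * mu (G `&` J i) <=
   mu (G `&` \big[setU/set0]_(i <- s) J i)
   + \sum_(i <- s) \sum_(j <- s) (t ^+ 2)%:E * mu (J i `&` J j))%E.
Proof.
move=> mG mJ t0.
have mU : measurable (\big[setU/set0]_(i <- s) J i) by exact: bigsetU_measurable.
have int1 (A : set T) (c : R) : measurable A -> 0 <= c ->
    (c%:E * mu A = \int[mu]_x (c * \1_A x)%:E)%E.
  move=> mA c0; under eq_integral do rewrite EFinM.
  rewrite ge0_integralZl_EFin //; last exact/measurable_EFinP.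
  by rewrite integral_indic // setIT.
have mI (A : set T) (c : R) : measurable A ->
    measurable_fun [set: T] (fun x => (c * \1_A x)%:E).
  by move=> mA; apply/measurable_EFinP; apply: measurable_funM.
have pI (A : set T) (c : R) x : 0 <= c -> (0 <= (c * \1_A x)%:E)%E.
  by move=> c0; rewrite lee_fin mulr_ge0.
have t2 : 0 <= t ^+ 2 by exact: sqr_ge0.
have tt : 0 <= 2 * t by rewrite mulr_ge0.
have mGU := measurableI _ _ mG mU.
have mGJ i : measurable (G `&` J i) by exact: measurableI.
have mJJ i j : measurable (J i `&` J j) by exact: measurableI.
have -> : (\sum_(i <- s) (2 * t)%:E * mu (G `&` J i) =
    \int[mu]_x (\sum_(i <- s) (2 * t * \1_(G `&` J i) x)%:E))%E.
  rewrite ge0_integral_sum //.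
  - by apply: eq_bigr => i _; rewrite int1.
  - by move=> i; exact: mI.
  - by move=> i x _; exact: pI.
have -> : (\sum_(i <- s) \sum_(j <- s) (t ^+ 2)%:E * mu (J i `&` J j) =
    \int[mu]_x (\sum_(i <- s) \sum_(j <- s) (t ^+ 2 * \1_(J i `&` J j) x)%:E))%E.
  rewrite ge0_integral_sum //.
  - apply: eq_bigr => i _; rewrite ge0_integral_sum //.
    + by apply: eq_bigr => j _; rewrite int1.
    + by move=> j; exact: mI.
    + by move=> j x _; exact: pI.
  - by move=> i; apply: emeasurable_sum => j; exact: mI.
  - by move=> i x _; apply: sume_ge0 => j _; exact: pI.
have -> : (mu (G `&` \big[setU/set0]_(i <- s) J i) =
    \int[mu]_x (1 * \1_(G `&` \big[setU/set0]_(i <- s) J i) x)%:E)%E.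
  by rewrite -(int1 _ 1 mGU ler01) mul1e.
rewrite -ge0_integralD //.
- apply: ge0_le_integral => //.
  + by move=> x _; apply: sume_ge0 => i _; exact: pI.
  + by apply: emeasurable_sum => i; exact: mI.
  + apply: emeasurable_funD; first exact: (mI _ 1 mGU).
    by apply: emeasurable_sum => i; apply: emeasurable_sum => j; exact: mI.
  + move=> x _; rewrite mul1r.
    under [X in (_ + X)%E]eq_bigr do rewrite sumEFin.
    by rewrite !sumEFin -EFinD lee_fin; exact: second_moment_pointwise.
- exact: (mI _ 1 mGU).
- by move=> x _; apply: sume_ge0 => i _; apply: sume_ge0 => j _; exact: pI.
- by apply: emeasurable_sum => i; apply: emeasurable_sum => j; exact: mI.
Qed.

(** * Lebesgue measure on [0, 1] with real values *)

Definition unit_measure (R : realType) (A : set R) : R :=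
  fine (lebesgue_measure (`[0, 1]%classic `&` A)).

Lemma unit_measureE (R : realType) (A : set R) : measurable A ->
  lebesgue_measure (`[0, 1]%classic `&` A) = (unit_measure A)%:E.
Proof.
move=> mA; rewrite /unit_measure fineK // ge0_fin_numE ?measure_ge0 //.
apply: le_lt_trans (_ : _ <= lebesgue_measure (`[0%R, 1%R]%classic : set R))%E _.
  by apply: le_measure; rewrite ?inE //; exact: measurableI.
by rewrite lebesgue_measure_itv /= lte_fin ltr01 oppr0 adde0 ltry.
Qed.

Lemma unit_measure_ge0 (R : realType) (A : set R) : 0 <= unit_measure A.
Proof. by rewrite /unit_measure fine_ge0 // measure_ge0. Qed.

Lemma le_unit_measure (R : realType) (A B : set R) : measurable A -> measurable B ->
  A `<=` B -> unit_measure A <= unit_measure B.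
Proof.
move=> mA mB AB; rewrite -lee_fin -!unit_measureE //.
by apply: le_measure; rewrite ?inE; [exact: measurableI|exact: measurableI|exact: setIS].
Qed.

Lemma unit_measureU (R : realType) (A B : set R) : measurable A -> measurable B ->
  A `&` B = set0 -> unit_measure (A `|` B) = unit_measure A + unit_measure B.
Proof.
move=> mA mB AB; apply: EFin_inj; rewrite EFinD -!unit_measureE //; last exact: measurableU.
rewrite setIUr measureU //; [exact: measurableI|exact: measurableI|].
by rewrite setIACA setIid AB setI0.
Qed.

Lemma unit_measureDI (R : realType) (A B : set R) : measurable A -> measurable B ->
  unit_measure A = unit_measure (A `\` B) + unit_measure (A `&` B).
Proof.
move=> mA mB; rewrite -unit_measureU ?setDE; first by rewrite -setIUr setUC setUv setIT.
- by apply: measurableI => //; exact: measurableC.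
- exact: measurableI.
- by rewrite setIACA setIid setICl setI0.
Qed.

Lemma unit_measure_oo_le (R : realType) (u v : R) : u <= v ->
  unit_measure `]u, v[%classic <= v - u.
Proof.
move=> uv; rewrite -lee_fin -unit_measureE //.
apply: le_trans (_ : lebesgue_measure (`]u, v[%classic : set R) <= _)%E.
  by apply: le_measure; rewrite ?inE //; exact: measurableI.
by rewrite lebesgue_measure_itv /= lte_fin; case: ifP => // _; rewrite lee_fin subr_ge0.
Qed.

Lemma unit_measure_cc_le (R : realType) (u v : R) : u <= v ->
  unit_measure `[u, v]%classic <= v - u.
Proof.
move=> uv; rewrite -lee_fin -unit_measureE //.
apply: le_trans (_ : lebesgue_measure (`[u, v]%classic : set R) <= _)%E.
  by apply: le_measure; rewrite ?inE //; exact: measurableI.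
by rewrite lebesgue_measure_itv /= lte_fin; case: ifP => // _; rewrite lee_fin subr_ge0.
Qed.

Lemma unit_measure_oo (R : realType) (u v : R) : 0 <= u -> u < v -> v <= 1 ->
  unit_measure `]u, v[%classic = v - u.
Proof.
move=> u0 uv v1; apply: EFin_inj; rewrite -unit_measureE //.
rewrite (_ : _ `&` _ = `]u, v[%classic); last first.
  apply/seteqP; split=> [x []//|x /=]; rewrite !in_itv /= => /andP[ux xv]; split.
    by rewrite (ltW (le_lt_trans u0 ux)) (ltW (lt_le_trans xv v1)).
  by rewrite ux.
by rewrite lebesgue_measure_itv /= lte_fin uv.
Qed.

Lemma second_moment_fine (d : measure_display) (T : measurableType d) (R : realType)
    (mu : {measure set T -> \bar R}) (m : set T -> R) (I : Type) (s : seq I)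
    (J : I -> set T) (G : set T) (t : R) :
  (forall A, measurable A -> mu A = (m A)%:E) ->
  measurable G -> (forall i, measurable (J i)) -> 0 <= t ->
  2 * t * \sum_(i <- s) m (G `&` J i) <=
  m (G `&` \big[setU/set0]_(i <- s) J i)
   + t ^+ 2 * \sum_(i <- s) \sum_(j <- s) m (J i `&` J j).
Proof.
move=> E mG mJ t0; have := second_moment mu s mG mJ t0.
have mU : measurable (\big[setU/set0]_(i <- s) J i) by exact: bigsetU_measurable.
rewrite (E _ (measurableI _ _ mG mU)).
under [X in (X <= _)%E]eq_bigr do rewrite (E _ (measurableI _ _ mG (mJ _))) -EFinM.
under [X in (_ <= _ + X)%E]eq_bigr => i _.
  under eq_bigr do rewrite (E _ (measurableI _ _ (mJ _) (mJ _))) -EFinM.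
  rewrite sumEFin; over.
rewrite !sumEFin -EFinD lee_fin -mulr_sumr => /le_trans; apply.
rewrite lerD2l mulr_sumr; apply: ler_sum => i _.
by rewrite mulr_sumr.
Qed.

Lemma second_moment_real (R : realType) (I : Type) (s : seq I) (J : I -> set R)
    (G : set R) (t : R) :
  measurable G -> (forall i, measurable (J i)) -> 0 <= t ->
  2 * t * \sum_(i <- s) unit_measure (G `&` J i) <=
  unit_measure (G `&` \big[setU/set0]_(i <- s) J i)
   + t ^+ 2 * \sum_(i <- s) \sum_(j <- s) unit_measure (J i `&` J j).
Proof.
have m01 : measurable (`[0, 1]%classic : set R) by [].
apply: (@second_moment_fine _ (measurableTypeR R) R (mrestr lebesgue_measure m01)) => A mA.
by rewrite /= /mrestr setIC; exact: unit_measureE.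
Qed.

(** * Equidistribution *)

(** Since [n <= totient n * 2 ^ omega(n)], it suffices that a large multiple of a power of
    [2 ^ omega(n)] be at most [n], which is [omega_small]. *)
Lemma sieve_error_small (R : realType) (e : R) : 0 < e ->
  exists n0 : nat, forall n : nat, (n0 <= n)%N ->
    3 * 2 ^+ size (primes n) <= e * (totient n)%:R.
Proof.
move=> e0; have [n0 Hn0] := omega_small (Num.truncn (3 / e)).+1.
exists n0.+1 => n n0n; have {Hn0} := Hn0 n (ltnW n0n).
set w := (2 ^ size (primes n))%N; have w_gt0 : (0 < w)%N by rewrite expn_gt0.
move=> /leq_trans /(_ (totient_lower n)); rewrite -/w => H.
have {}H : ((Num.truncn (3 / e)).+1 * w <= totient n)%N.
  rewrite -(leq_pmul2r w_gt0) (leq_trans _ H) // -mulnA leq_mul //.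
  by rewrite -{1}(expn1 w) -expnSr leq_pexp2l.
have := H; rewrite -(ler_nat R) natrM => {}H.
have tE : 3 / e <= (Num.truncn (3 / e)).+1%:R by rewrite ltW // truncnS_gt.
rewrite -natrX -/w -ler_pdivrMl // mulrA; apply: le_trans H.
by rewrite ler_wpM2r // mulrC.
Qed.

(** With [D n = psi n / n], a lift to the real line of one arc of E_n; nothing is wrapped modulo
    1. *)
Definition approx_itv (R : realType) (D : nat -> R) (n a : nat) : set R :=
  `]a%:R / n%:R - D n, a%:R / n%:R + D n[%classic.

Lemma measurable_approx_itv (R : realType) (D : nat -> R) (n a : nat) :
  measurable (approx_itv D n a).
Proof. exact: measurable_itv. Qed.

Definition minus_intervals (R : realType) (u v : R) (L : seq (R * R)) : set R :=
  `[u, v]%classic `\` \big[setU/set0]_(l <- L) `]l.1, l.2[%classic.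

Lemma measurable_minus_intervals (R : realType) (u v : R) (L : seq (R * R)) :
  measurable (minus_intervals u v L).
Proof. by apply: measurableD => //; exact: bigsetU_measurable. Qed.

(** Removing []l.1, l.2[] leaves a piece on its left and one on its right, either of which may be
    empty. This reduces a finite union of intervals to single intervals by induction. *)
Lemma minus_intervals_cons (R : realType) (u v : R) (l : R * R) (L : seq (R * R)) :
  l.1 < l.2 ->
  minus_intervals u v (l :: L) =
    minus_intervals u (Num.min v l.1) L `|` minus_intervals (Num.max u l.2) v L /\
  minus_intervals u (Num.min v l.1) L `&` minus_intervals (Num.max u l.2) v L = set0.
Proof.
move=> l12; rewrite /minus_intervals big_cons; split.
  apply/seteqP; split=> x /=; rewrite !in_itv /=.
    move=> [/andP[ux xv] /not_orP[xl xL]].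
    have [xl1|l1x] := leP x l.1; [left|right]; split=> //; rewrite ?le_min ?ge_max.
      by rewrite ux xv.
    by rewrite ux xv andbT /= leNgt; apply/negP => xl2; apply: xl; rewrite l1x.
  case=> -[]; rewrite ?le_min ?ge_max => /andP[].
    move=> ux /andP[xv xl] xL; split; first by rewrite ux.
    by apply/not_orP; split=> //; rewrite ltNge xl.
  move=> /andP[ux lx] xv xL; split; first by rewrite ux.
  by apply/not_orP; split=> //; rewrite [x < _]ltNge lx andbF.
apply/seteqP; split=> // x /= [[+ _] [+ _]]; rewrite !in_itv /= le_min ge_max.
move=> /andP[_ /andP[_ xl]] /andP[/andP[_ lx] _].
by have := lt_le_trans l12 (le_trans lx xl); rewrite ltxx.
Qed.

(** The statement is additive over disjoint sets, so induction on [L] reduces it to one interval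
    [[u, v]], where [coprime_count_lower] applies; [D n] tends to 0, and the sieve error is small
    compared with [totient n]. *)
Lemma equidistribution (R : realType) (A : pred nat) (D : nat -> R) (u v : R)
    (L : seq (R * R)) (e : R) :
  (exists n0 : nat, forall n, (n0 <= n)%N -> A n -> 0 < D n /\ D n ^+ 2 * n%:R < 1) ->
  (forall l, l \in L -> l.1 < l.2) -> 0 <= u -> v <= 1 -> 0 < e ->
  exists n0 : nat, forall n, (n0 <= n)%N -> A n ->
    2 * D n * (totient n)%:R * (unit_measure (minus_intervals u v L) - e) <=
    \sum_(1 <= a < n.+1 | coprime a n)
      unit_measure (minus_intervals u v L `&` approx_itv D n a).
Proof.
move=> [n0 Dn0]; elim: L u v e => [|l L IH] u v e LP u0 v1 e0; last first.
  have lL : l.1 < l.2 by apply: LP; rewrite mem_head.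
  have {}LP l' : l' \in L -> l'.1 < l'.2 by move=> l'L; apply: LP; rewrite inE l'L orbT.
  have e2 : 0 < e / 2 by lra.
  have min1 : Num.min v l.1 <= 1 by rewrite ge_min v1.
  have max0 : 0 <= Num.max u l.2 by rewrite le_max u0.
  have [n1 H1] := IH u (Num.min v l.1) (e / 2) LP u0 min1 e2.
  have [n2 H2] := IH (Num.max u l.2) v (e / 2) LP max0 v1 e2.
  exists (maxn n1 n2) => n; rewrite geq_max => /andP[n1n n2n] An.
  have [-> disj] := minus_intervals_cons u v L lL.
  set V1 := minus_intervals u _ L in disj *; set V2 := minus_intervals _ v L in disj *.
  have mV1 : measurable V1 by exact: measurable_minus_intervals.
  have mV2 : measurable V2 by exact: measurable_minus_intervals.
  rewrite unit_measureU //.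
  have -> : \sum_(1 <= a < n.+1 | coprime a n)
      unit_measure ((V1 `|` V2) `&` approx_itv D n a) =
     \sum_(1 <= a < n.+1 | coprime a n) unit_measure (V1 `&` approx_itv D n a) +
     \sum_(1 <= a < n.+1 | coprime a n) unit_measure (V2 `&` approx_itv D n a).
    rewrite -big_split; apply: eq_bigr => a _ /=; rewrite setIUl unit_measureU //.
    - by apply: measurableI => //; exact: measurable_approx_itv.
    - by apply: measurableI => //; exact: measurable_approx_itv.
    - by rewrite setIACA disj set0I.
  have := H1 n n1n An; have := H2 n n2n An; rewrite -/V1 -/V2; nra.
have [n1 Hn1] := sieve_error_small (divr_gt0 e0 (ltr0n _ 2)).
(* From [n > (4 / e) ^ 2] and [D n ^ 2 * n < 1] follows [D n < e / 4]. *)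
pose n2 := (Num.truncn ((4 / e) ^+ 2)).+1.
exists (maxn n0 (maxn n1 n2)) => n; rewrite !geq_max => /and3P[n0n n1n n2n] An.
have [D0 D2] := Dn0 n n0n An; have {Hn1} err := Hn1 n n1n.
have n_gt0 : (0 < n)%N by apply: leq_trans n2n.
have nR : 0 < n%:R :> R by rewrite ltr0n.
have De : D n < e / 4.
  have ne : (4 / e) ^+ 2 < n%:R.
    by apply: lt_le_trans (truncnS_gt _) _; rewrite ler_nat.
  rewrite ltNge; apply/negP => eD.
  have : (e / 4) ^+ 2 <= D n ^+ 2 by rewrite ler_sqr ?nnegrE //; lra.
  move=> eD2; have : 1 < D n ^+ 2 * n%:R; last by lra.
  apply: lt_le_trans (_ : (e / 4) ^+ 2 * n%:R <= _); last by rewrite ler_wpM2r // ltW.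
  have E1 : (e / 4) ^+ 2 * (4 / e) ^+ 2 = 1 by field; rewrite gt_eqF.
  by rewrite -[ltLHS]E1 ltr_pM2l // exprn_gt0 // divr_gt0.
rewrite /minus_intervals big_nil setD0.
have sum0 : 0 <= \sum_(1 <= a < n.+1 | coprime a n)
    unit_measure (`[u, v]%classic `&` approx_itv D n a).
  by apply: sumr_ge0 => a _; exact: unit_measure_ge0.
have phi0 : 0 <= (totient n)%:R :> R by [].
(* If the measure is at most [e], the left side of the goal is nonpositive. Otherwise [e < v - u],
   which leaves room for [u + D n <= v - D n]. *)
have [small|big] := leP (unit_measure `[u, v]%classic) e.
  apply: le_trans sum0; rewrite mulr_ge0_le0 ?subr_le0 //.
  by rewrite !mulr_ge0 // ltW.
have [uv|vu] := leP u v; last first.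
  move: big; rewrite set_itv_ge ?bnd_simp -?ltNge //.
  have : unit_measure (set0 : set R) = 0 by rewrite /unit_measure setI0 measure0.
  by move=> ->; lra.
have len := unit_measure_cc_le uv.
have uv' : u + D n <= v - D n by lra.
have u0' : 0 <= u + D n by lra.
have v1' : v - D n <= 1 by lra.
have cnt := coprime_count_lower n_gt0 u0' uv' v1'.
(* Only the centres at distance at least [D n] from both ends are kept; their intervals lie inside
   [[u, v]] and count with full length [2 * D n]. *)
apply: le_trans (_ : \sum_(1 <= a < n.+1 | coprime a n &&
    (u + D n < a%:R / n%:R <= v - D n)) 2 * D n <= _); last first.
  rewrite big_mkcondr; apply: ler_sum => a _; case: ifP => [/andP[ua av]|_]; last first.
    exact: unit_measure_ge0.
  rewrite (_ : _ `&` _ = approx_itv D n a).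
    by rewrite unit_measure_oo; lra.
  apply/setIidPr => x; rewrite /approx_itv /= !in_itv /= => /andP[x1 x2].
  by apply/andP; split; lra.
have E : \sum_(1 <= a < n.+1 | coprime a n && (u + D n < a%:R / n%:R <= v - D n)) 2 * D n
    = 2 * D n * \sum_(1 <= a < n.+1 | coprime a n &&
    (u + D n < a%:R / n%:R <= v - D n)) 1.
  by rewrite mulr_sumr; apply: eq_bigr => a _; rewrite mulr1.
rewrite E -mulrA ler_wpM2l //; first lra.
apply: le_trans cnt.
have : (totient n)%:R * (unit_measure `[u, v]%classic - e) <=
    (totient n)%:R * ((v - D n) - (u + D n) - e / 2) by rewrite ler_wpM2l //; lra.
move/le_trans; apply; rewrite mulrBr; lra.
Qed.

(** * Covering [0, 1] step by step *)

Definition reduced_fractions (A : pred nat) (N M : nat) : seq (nat * nat) :=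
  [seq (n, a) | n <- [seq n <- index_iota N M | A n],
                a <- [seq a <- index_iota 1 n.+1 | coprime a n]].

Lemma sum_reduced_fractions (R : nmodType) (A : pred nat) (N M : nat)
    (F : nat * nat -> R) :
  \sum_(x <- reduced_fractions A N M) F x =
  \sum_(N <= n < M | A n) \sum_(1 <= a < n.+1 | coprime a n) F (n, a).
Proof.
rewrite /reduced_fractions big_allpairs_dep big_filter.
by apply: eq_bigr => n _; rewrite big_filter.
Qed.

Lemma mem_reduced_fractions (A : pred nat) (N M n a : nat) :
  ((n, a) \in reduced_fractions A N M) =
  [&& A n, (N <= n < M)%N, (1 <= a <= n)%N & coprime a n].
Proof.
apply/allpairsPdep/idP => [[n' [a' []]]|/and4P[An nNM an cop]].
  rewrite !mem_filter !mem_index_iota ltnS => /andP[An nNM] /andP[cop an] [-> ->].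
  by rewrite An nNM an cop.
by exists n, a; rewrite !mem_filter !mem_index_iota ltnS An nNM an cop.
Qed.

Definition approx_union (R : realType) (A : pred nat) (D : nat -> R) (N M : nat) : set R :=
  \big[setU/set0]_(x <- reduced_fractions A N M) approx_itv D x.1 x.2.

Lemma measurable_approx_union (R : realType) (A : pred nat) (D : nat -> R) (N M : nat) :
  measurable (approx_union A D N M).
Proof. by apply: bigsetU_measurable => x _; exact: measurable_approx_itv. Qed.

Lemma approx_unionP (R : realType) (A : pred nat) (D : nat -> R) (N M : nat) (x : R) :
  approx_union A D N M x <->
  exists n a, [/\ A n, (N <= n < M)%N, (1 <= a <= n)%N, coprime a n & approx_itv D n a x].
Proof.
rewrite /approx_union -bigcup_seq; split.
  move=> [[n a] /=]; rewrite mem_reduced_fractions => /and4P[An nNM an cop] xJ.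
  by exists n, a.
move=> [n [a [An nNM an cop xJ]]]; exists (n, a) => //=.
by rewrite mem_reduced_fractions An nNM an cop.
Qed.

Lemma approx_unionS (R : realType) (A : pred nat) (D : nat -> R) (N M N' M' : nat) :
  (N <= N')%N -> (M' <= M)%N -> approx_union A D N' M' `<=` approx_union A D N M.
Proof.
move=> NN MM x /approx_unionP[n [a [An /andP[Nn nM] an cop xJ]]].
apply/approx_unionP; exists n, a; split=> //.
by rewrite (leq_trans NN Nn) (leq_trans nM MM).
Qed.

Lemma count_coprime (R : pzSemiRingType) (n : nat) : (1 < n)%N ->
  \sum_(1 <= a < n.+1 | coprime a n) 1 = (totient n)%:R :> R.
Proof.
move=> n1; rewrite big_mkcond big_nat_recr ?(ltnW n1) //= /coprime gcdnn gtn_eqF // addr0.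
rewrite totient_count_coprime natr_sum [RHS]big_ltn ?(ltnW n1) //.
rewrite /coprime gcdn0 gtn_eqF // add0r; apply: eq_bigr => a _.
by rewrite gcdnC; case: eqP.
Qed.

Lemma unit_interval_minus_approx (R : realType) (A : pred nat) (D : nat -> R) (N M : nat) :
  `[0, 1]%classic `\` approx_union A D N M =
  minus_intervals 0 1 [seq (x.2%:R / x.1%:R - D x.1, x.2%:R / x.1%:R + D x.1)
                          | x <- reduced_fractions A N M].
Proof.
by rewrite /minus_intervals big_map /approx_union.
Qed.

(** Apply the second moment method to the uncovered set [G], of measure [z], over a window of later
    [n] on which the sum [S] of [D n * totient n] is at least 1. The first moment is at least
    [S * z] by equidistribution with error [z / 2]; the second is at most [C * S ^ 2 + 2 * S], hence
    at most [(C + 2) * S ^ 2]. *)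
Lemma cover_step (R : realType) (A : pred nat) (D : nat -> R) (C : R) (N0 N M : nat) :
  0 <= C -> (1 < N0)%N ->
  (forall n, (N0 <= n)%N -> A n -> 0 < D n /\ D n ^+ 2 * n%:R < 1) ->
  (forall m n, (N0 <= m)%N -> (N0 <= n)%N -> A m -> A n ->
     \sum_(1 <= a < m.+1 | coprime a m) \sum_(1 <= b < n.+1 | coprime b n)
        unit_measure (approx_itv D m a `&` approx_itv D n b) <=
     C * (D m * (totient m)%:R) * (D n * (totient n)%:R)
       + (m == n)%:R * (2 * (D n * (totient n)%:R))) ->
  (forall K B, exists K', B <= \sum_(K <= n < K' | A n) D n * (totient n)%:R) ->
  (N0 <= N)%N ->
  let z := unit_measure (`[0, 1]%classic `\` approx_union A D N M) in
  0 < z ->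
  exists M', unit_measure (`[0, 1]%classic `\` approx_union A D N M') <=
             z - z ^+ 2 / (C + 2).
Proof.
move=> C0 N0_gt1 DA overlap div N0N z z0; pose G := `[0, 1]%classic `\` approx_union A D N M.
have mI01 : measurable (`[0, 1]%classic : set R) by [].
have mG : measurable G by apply: measurableD => //; exact: measurable_approx_union.
have z2 : 0 < z / 2 by lra.
have [n0 Hn0] : exists n0 : nat, forall n, (n0 <= n)%N -> A n ->
    2 * D n * (totient n)%:R * (z - z / 2) <=
    \sum_(1 <= a < n.+1 | coprime a n) unit_measure (G `&` approx_itv D n a).
  rewrite /z /G unit_interval_minus_approx; apply: equidistribution => //.
  - by exists N0.
  - move=> l /mapP[[n a]]; rewrite mem_reduced_fractions => /and4P[An /andP[Nn _] _ _] -> /=.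
    have [D0 _] := DA n (leq_trans N0N Nn) An; lra.
  - by rewrite -unit_interval_minus_approx.
pose M0 := maxn N (maxn M n0).
have [M1 HM1] := div M0 1.
set S := \sum_(M0 <= n < M1 | A n) _ in HM1.
pose s := reduced_fractions A M0 M1.
have big_n n : (M0 <= n)%N -> (N0 <= n)%N /\ (n0 <= n)%N.
  by rewrite !geq_max => /and3P[Nn _ n0n]; split=> //; exact: leq_trans Nn.
have first_moment : S * z <= \sum_(x <- s) unit_measure (G `&` approx_itv D x.1 x.2).
  rewrite sum_reduced_fractions mulr_suml big_nat_cond [leRHS]big_nat_cond.
  apply: ler_sum => n /andP[/andP[/big_n[_ n0n] _] An].
  by have := Hn0 n n0n An; lra.
have second_mom : \sum_(x <- s) \sum_(y <- s)
    unit_measure (approx_itv D x.1 x.2 `&` approx_itv D y.1 y.2) <= C * S ^+ 2 + 2 * S.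
  have -> : \sum_(x <- s) \sum_(y <- s)
      unit_measure (approx_itv D x.1 x.2 `&` approx_itv D y.1 y.2) =
    \sum_(M0 <= m < M1 | A m) \sum_(M0 <= n < M1 | A n)
     \sum_(1 <= a < m.+1 | coprime a m) \sum_(1 <= b < n.+1 | coprime b n)
        unit_measure (approx_itv D m a `&` approx_itv D n b).
    rewrite sum_reduced_fractions; apply: eq_bigr => m _.
    rewrite [RHS]exchange_big /=; apply: eq_bigr => a _; exact: sum_reduced_fractions.
  have -> : C * S ^+ 2 + 2 * S = \sum_(M0 <= m < M1 | A m) \sum_(M0 <= n < M1 | A n)
     (C * (D m * (totient m)%:R) * (D n * (totient n)%:R)
       + (m == n)%:R * (2 * (D n * (totient n)%:R))).
    under eq_bigr do rewrite big_split /=.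
    rewrite big_split /=; congr (_ + _).
      have -> : C * S ^+ 2 = \sum_(M0 <= m < M1 | A m) C * (D m * (totient m)%:R) * S.
        by rewrite -mulr_suml -mulr_sumr expr2 mulrA.
      by apply: eq_bigr => m _; rewrite mulr_sumr.
    have -> : 2 * S = \sum_(M0 <= m < M1 | A m) 2 * (D m * (totient m)%:R).
      by rewrite -mulr_sumr.
    rewrite [LHS]big_nat_cond [RHS]big_nat_cond; apply: eq_bigr => m /andP[mM Am].
    rewrite -big_filter (bigD1_seq m) /= ?mem_filter ?Am ?mem_index_iota //;
      last by rewrite filter_uniq // iota_uniq.
    rewrite eqxx mul1r big1 ?addr0 // => n nm.
    by rewrite eq_sym (negbTE nm) mul0r.
  rewrite big_nat_cond [leRHS]big_nat_cond; apply: ler_sum => m /andP[/andP[/big_n[N0m _] _] Am].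
  rewrite big_nat_cond [leRHS]big_nat_cond; apply: ler_sum => n /andP[/andP[/big_n[N0n _] _] An].
  exact: overlap.
have S0 : 0 < S by lra.
(* The maximizer of [2 * t * (S * z) - t ^ 2 * ((C + 2) * S ^ 2)], whose maximum is
   [z ^ 2 / (C + 2)]. *)
pose t := z / ((C + 2) * S).
have C2 : 0 < C + 2 by lra.
have t0 : 0 <= t by rewrite divr_ge0 ?mulr_ge0 // ltW.
have moment := @second_moment_real R _ s (fun x => approx_itv D x.1 x.2) G t mG
  (fun x => measurable_approx_itv D x.1 x.2) t0.
have gain : z ^+ 2 / (C + 2) <= unit_measure (G `&` approx_union A D M0 M1).
  have tS : t * S = z / (C + 2) by rewrite /t; field; rewrite !gt_eqF.
  have H1 : 2 * t * (S * z) <= 2 * t * \sum_(x <- s) unit_measure (G `&` approx_itv D x.1 x.2).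
    by rewrite ler_wpM2l // mulr_ge0.
  have H2 : t ^+ 2 * \sum_(x <- s) \sum_(y <- s)
      unit_measure (approx_itv D x.1 x.2 `&` approx_itv D y.1 y.2)
      <= t ^+ 2 * ((C + 2) * S ^+ 2).
    rewrite ler_wpM2l ?sqr_ge0 //; apply: le_trans second_mom _.
    have SS : S <= S ^+ 2 by rewrite expr2 ler_peMl // ltW.
    have -> : (C + 2) * S ^+ 2 = C * S ^+ 2 + 2 * S ^+ 2 by ring.
    lra.
  have E1 : 2 * t * (S * z) = 2 * (z ^+ 2 / (C + 2)).
    by rewrite [LHS](_ : _ = 2 * (t * S) * z); [rewrite tS; ring|ring].
  have E2 : t ^+ 2 * ((C + 2) * S ^+ 2) = z ^+ 2 / (C + 2).
    rewrite [LHS](_ : _ = (t * S) ^+ 2 * (C + 2)); last by ring.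
    by rewrite tS; field; rewrite gt_eqF.
  have E3 : unit_measure (G `&` approx_union A D M0 M1) =
     unit_measure (G `&` \big[setU/set0]_(i <- s) approx_itv D i.1 i.2) by [].
  by rewrite E3; lra.
exists (maxn M M1).
have mU := measurable_approx_union A D M0 M1.
apply: le_trans (_ : unit_measure (G `\` approx_union A D M0 M1) <= _); last first.
  by have := unit_measureDI mG mU; rewrite -/z; move: gain; rewrite -/G -/z; lra.
apply: le_unit_measure.
- by apply: measurableD => //; exact: measurable_approx_union.
- exact: measurableD.
move=> x [x01 xU]; split.
  by split=> // xU'; apply: xU; apply: approx_unionS xU'; rewrite ?leq_maxl.
by move=> xU'; apply: xU; apply: approx_unionS xU'; rewrite ?leq_maxl ?leq_maxr.
Qed.

(** As long as the uncovered measure exceeds [e], each [cover_step] removes at least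
    [e ^ 2 / (C + 2)], so finitely many steps suffice. *)
Lemma cover_of_overlap (R : realType) (A : pred nat) (D : nat -> R) (C : R) (N0 : nat) :
  0 <= C -> (1 < N0)%N ->
  (forall n, (N0 <= n)%N -> A n -> 0 < D n /\ D n ^+ 2 * n%:R < 1) ->
  (forall m n, (N0 <= m)%N -> (N0 <= n)%N -> A m -> A n ->
     \sum_(1 <= a < m.+1 | coprime a m) \sum_(1 <= b < n.+1 | coprime b n)
        unit_measure (approx_itv D m a `&` approx_itv D n b) <=
     C * (D m * (totient m)%:R) * (D n * (totient n)%:R)
       + (m == n)%:R * (2 * (D n * (totient n)%:R))) ->
  (forall K B, exists K', B <= \sum_(K <= n < K' | A n) D n * (totient n)%:R) ->
  forall (N : nat) (e : R), (N0 <= N)%N -> 0 < e ->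
  exists M, unit_measure (`[0, 1]%classic `\` approx_union A D N M) <= e.
Proof.
move=> C0 N0_gt1 DA overlap div N e N0N e0.
have C2 : 0 < C + 2 by lra.
pose c := e ^+ 2 / (C + 2).
have c0 : 0 < c by rewrite divr_gt0 // exprn_gt0.
apply: contrapT => /forallNP none.
have large M : e < unit_measure (`[0, 1]%classic `\` approx_union A D N M).
  by rewrite ltNge; apply/negP; exact: none.
have iter k : exists M, unit_measure (`[0, 1]%classic `\` approx_union A D N M) <=
    1 - k%:R * c.
  elim: k => [|k [M HM]].
    exists 0%N; rewrite mul0r subr0; apply: le_trans (_ : unit_measure `[0, 1]%classic <= _).
      apply: le_unit_measure; [|by []|exact: subDsetl].
      by apply: measurableD => //; exact: measurable_approx_union.
    by have := unit_measure_cc_le (@ler01 R); lra.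
  have lM := large M.
  have [M' HM'] := cover_step C0 N0_gt1 DA overlap div N0N (lt_trans e0 lM).
  exists M'; apply: le_trans HM' _.
  set z := unit_measure _ in HM lM *.
  have : c <= z ^+ 2 / (C + 2).
    have z0 : 0 <= z by lra.
    apply: ler_wpM2r; first by rewrite invr_ge0 ltW.
    by rewrite ler_sqr ?nnegrE //; exact: ltW.
  have -> : k.+1%:R = k%:R + 1 :> R by rewrite natr1.
  by rewrite mulrDl mul1r; lra.
have [M HM] := iter (Num.truncn (1 / c)).+1.
have := large M; have : 1 / c < (Num.truncn (1 / c)).+1%:R by exact: truncnS_gt.
rewrite ltr_pdivrMr // => H1 H2; lra.
Qed.

(** * Overlaps *)

(** The integral over [0, 1] of the product of the numbers of intervals with denominators [m] and
    [n] through a point. *)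
Definition overlap (R : realType) (D : nat -> R) (m n : nat) : R :=
  \sum_(1 <= a < m.+1 | coprime a m) \sum_(1 <= b < n.+1 | coprime b n)
    unit_measure (approx_itv D m a `&` approx_itv D n b).

Lemma overlapC (R : realType) (D : nat -> R) (m n : nat) : overlap D m n = overlap D n m.
Proof.
rewrite /overlap exchange_big; apply: eq_bigr => a _; apply: eq_bigr => b _.
by rewrite setIC.
Qed.

(** Intervals that meet have centres closer than [D m + D n], and their intersection is no longer
    than the shorter one. Counting close centres will give a factor [max], and
    [min * max = D m * D n]. *)
Lemma unit_measure_approx_itvI (R : realType) (D : nat -> R) (m n a b : nat) :
  0 < D m -> 0 < D n ->
  unit_measure (approx_itv D m a `&` approx_itv D n b) <=
  2 * Num.min (D m) (D n) *
  (`|a%:R / m%:R - b%:R / n%:R| < 2 * Num.max (D m) (D n) :> R)%:R.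
Proof.
move=> m0 n0; have mJ k c : measurable (approx_itv D k c) by exact: measurable_approx_itv.
case: ltP => far /=.
  rewrite mulr1 minr_pMr //.
  rewrite le_min; apply/andP; split.
    apply: le_trans (_ : unit_measure (approx_itv D m a) <= _).
      by apply: le_unit_measure => //; exact: measurableI.
    by apply: le_trans (unit_measure_oo_le _) _; lra.
  apply: le_trans (_ : unit_measure (approx_itv D n b) <= _).
    by apply: le_unit_measure => //; exact: measurableI.
  by apply: le_trans (unit_measure_oo_le _) _; lra.
rewrite mulr0 (_ : _ `&` _ = set0) ?/unit_measure ?setI0 ?measure0 //.
apply/seteqP; split=> // x [] /=; rewrite /approx_itv /= !in_itv /=.
move=> /andP[x1 x2] /andP[x3 x4]; move: far; apply/negP; rewrite -ltNge.
have Dm : D m <= Num.max (D m) (D n) by rewrite le_max lexx.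
have Dn : D n <= Num.max (D m) (D n) by rewrite le_max lexx orbT.
by rewrite ltr_norml; apply/andP; split; lra.
Qed.

(** For each [b / n], the sieve counts the [a / m] within [2 * M] of it: the main term is
    [4 * M * totient m], and the error is at most [M * totient m] because [M >= D n >= n ^ -3] and
    [m] is large compared with [n]. The sum 5, times the 2 of [unit_measure_approx_itvI], makes
    10. *)
Lemma overlap_cross_scale (R : realType) : exists N0 : nat,
  forall (D : nat -> R) (m n : nat), (N0 <= m)%N -> (1 < n)%N -> (n ^ 4 <= m)%N ->
    0 < D m -> n%:R ^- 3 <= D n ->
  overlap D m n <= 10 * (D m * (totient m)%:R) * (D n * (totient n)%:R).
Proof.
have [N0 HN0] := omega_small 81.
exists N0 => D m n N0m n1 nm Dm Dn.
have n_gt0 : (0 < n)%N by exact: ltnW.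
have m_gt0 : (0 < m)%N by apply: leq_trans nm; rewrite expn_gt0 n_gt0.
have nR : 0 < n%:R :> R by rewrite ltr0n.
have n3 : 0 < n%:R ^- 3 :> R by rewrite invr_gt0 exprn_gt0.
have Dn0 : 0 < D n by exact: lt_le_trans Dn.
set w := (2 ^ size (primes m))%N in HN0.
have {}HN0 := HN0 m N0m; rewrite -/w in HN0.
pose M := Num.max (D m) (D n).
have DM : D n <= M by rewrite le_max lexx orbT.
have M0 : 0 < M by exact: lt_le_trans DM.
have w_gt0 : (0 < w)%N by rewrite expn_gt0.
(* Fourth powers turn [n ^ 3] into [(n ^ 4) ^ 3 <= m ^ 3]; the remaining [81 * w ^ 8 <= m], with
   [81 = 3 ^ 4], is the choice of [N0]. *)
have wn : (3 * w * n ^ 3 <= totient m)%N.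
  rewrite -(leq_pmul2r w_gt0); apply: leq_trans (totient_lower m).
  rewrite -(@leq_exp2r _ _ 4) //.
  have -> : ((3 * w * n ^ 3 * w) ^ 4 = 81 * w ^ 8 * (n ^ 4) ^ 3)%N by ring.
  have -> : (m ^ 4 = m * m ^ 3)%N by rewrite -expnS.
  by rewrite leq_mul // leq_exp2r.
have err : 3 * 2 ^+ size (primes m) <= (totient m)%:R * M.
  apply: le_trans (_ : (totient m)%:R * n%:R ^- 3 <= _).
    rewrite ler_pdivlMr ?exprn_gt0 // -!natrX -!natrM ler_nat; exact: wn.
  by rewrite ler_wpM2l // (le_trans Dn).
rewrite overlapC /overlap.
have inner b : \sum_(1 <= a < m.+1 | coprime a m)
    unit_measure (approx_itv D n b `&` approx_itv D m a) <=
    10 * (D m * (totient m)%:R) * D n.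
  apply: le_trans (_ : 2 * Num.min (D m) (D n) * \sum_(1 <= a < m.+1 | coprime a m &&
     (b%:R / n%:R - 2 * M < a%:R / m%:R < b%:R / n%:R + 2 * M)) 1 <= _).
    rewrite big_mkcondr mulr_sumr; apply: ler_sum => a _; rewrite setIC.
    apply: le_trans (unit_measure_approx_itvI a b Dm Dn0) _.
    rewrite -/M ltr_norml.
    have -> : (- (2 * M) < a%:R / m%:R - b%:R / n%:R < 2 * M) =
              (b%:R / n%:R - 2 * M < a%:R / m%:R < b%:R / n%:R + 2 * M).
      by congr andb; apply/idP/idP; lra.
    by case: ifP => _.
  have uv : b%:R / n%:R - 2 * M <= b%:R / n%:R + 2 * M by lra.
  have := coprime_count_upper m_gt0 uv.
  set X := \sum_(_ <= _ < _ | _) _ => HX.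
  have {}HX : X <= 5 * ((totient m)%:R * M) by apply: le_trans HX _; lra.
  have min0 : 0 <= 2 * Num.min (D m) (D n) by rewrite mulr_ge0 // le_min !ltW.
  apply: le_trans (ler_wpM2l min0 HX) _.
  have : Num.min (D m) (D n) * M = D m * D n by rewrite /M; case: leP => _ //; rewrite mulrC.
  rewrite le_eqVlt => E; apply/orP; left; apply/eqP.
  rewrite [RHS](_ : _ = 10 * (totient m)%:R * (D m * D n)); last by ring.
  by rewrite -E; ring.
apply: le_trans (_ : \sum_(1 <= b < n.+1 | coprime b n)
   10 * (D m * (totient m)%:R) * D n * 1 <= _).
  by apply: ler_sum => b _; rewrite mulr1.
by rewrite -mulr_sumr count_coprime // -!mulrA.
Qed.

Lemma sum_close_pairs (R : realType) (k m n : nat) (M : R) :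
  (0 < k)%N -> (1 < m < 2 ^ (4 ^ k.+1))%N -> (1 < n < 2 ^ (4 ^ k.+1))%N ->
  (forall p, (p <= 2 ^ k)%N -> logn p m = logn p n) -> 0 <= M ->
  \sum_(1 <= a < m.+1 | coprime a m) \sum_(1 <= b < n.+1 | coprime b n)
     ((b * m < a * n)%N && (a%:R / m%:R - b%:R / n%:R < 2 * M :> R))%:R <=
  2 * expR 25 * M * (totient m)%:R * (totient n)%:R.
Proof.
move=> k_gt0 /andP[m1 m_lt] /andP[n1 n_lt] vals M0.
have [m_gt0 n_gt0] : (0 < m)%N /\ (0 < n)%N by split; exact: ltnW.
pose near (x : nat * nat) :=
  (x.2 * m < x.1 * n)%N && (x.1%:R / m%:R - x.2%:R / n%:R < 2 * M :> R).
pose s := [seq x <- [seq (a, b) | a <- [seq a <- index_iota 1 m.+1 | coprime a m],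
                                  b <- [seq b <- index_iota 1 n.+1 | coprime b n]] | near x].
have -> : \sum_(1 <= a < m.+1 | coprime a m) \sum_(1 <= b < n.+1 | coprime b n)
     ((b * m < a * n)%N && (a%:R / m%:R - b%:R / n%:R < 2 * M :> R))%:R =
    (size s)%:R :> R.
  rewrite /s size_filter -sum1_count natr_sum [RHS]big_mkcond [RHS]big_allpairs_dep [RHS]big_filter.
  apply: eq_bigr => a _; rewrite [RHS]big_filter; apply: eq_bigr => b _.
  by rewrite /near /=; case: ifP.
have [mR nR] : 0 < m%:R :> R /\ 0 < n%:R :> R by rewrite !ltr0n.
have T0 : 0 <= 2 * M * (m%:R * n%:R) by rewrite !mulr_ge0.
apply: le_trans (@close_pairs_count R k m n (2 * M * (m%:R * n%:R)) s k_gt0 _ _ vals T0 _ _) _.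
- by rewrite m_gt0.
- by rewrite n_gt0.
- rewrite filter_uniq // allpairs_uniq ?filter_uniq ?iota_uniq //.
  by move=> [a b] [a' b'] _ _ /= [-> ->].
- move=> [a b]; rewrite mem_filter => /andP[/andP[/= lt_ba ltM]].
  move=> /allpairsP[[a' b'] /= [+ + []]] aE bE; rewrite -aE -bE.
  rewrite !mem_filter !mem_index_iota !ltnS => /andP[am /andP[a0 a_le]] /andP[bn _].
  split=> //.
    rewrite ltn_neqAle a_le andbT; apply: contraTneq am => ->.
    by rewrite /coprime gcdnn gtn_eqF.
  move: ltM; rewrite -(ltr_pM2r (mulr_gt0 mR nR)).
  have -> : (a%:R / m%:R - b%:R / n%:R) * (m%:R * n%:R) = (a * n)%:R - (b * m)%:R :> R.
    by rewrite !natrM; field; rewrite !gt_eqF.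
  by [].
rewrite le_eqVlt; apply/orP; left; apply/eqP.
by field; rewrite !gt_eqF.
Qed.

Lemma reduced_eq (a b m n : nat) : (0 < m)%N -> (0 < n)%N -> coprime a m -> coprime b n ->
  (a * n = b * m)%N -> m = n /\ a = b.
Proof.
move=> m_gt0 n_gt0 am bn E.
have mn : (m %| n)%N by rewrite -(Gauss_dvdr n (_ : coprime m a)) 1?coprime_sym // E dvdn_mull.
have nm : (n %| m)%N by rewrite -(Gauss_dvdr m (_ : coprime n b)) 1?coprime_sym // -E dvdn_mull.
have mnE : m = n by apply/eqP; rewrite eqn_dvd mn.
by split=> //; move: E; rewrite mnE => /eqP; rewrite eqn_pmul2r // => /eqP.
Qed.

(** The pairs are split by the sign of [a * n - b * m]. Each strict sign is bounded by
    [sum_close_pairs], and 8 is [2 * 2] for each of the two signs; equality of reduced fractions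
    occurs only for [m = n], [a = b] and gives the diagonal term. *)
Lemma overlap_same_scale (R : realType) (D : nat -> R) (k m n : nat) :
  (0 < k)%N -> (1 < m < 2 ^ (4 ^ k.+1))%N -> (1 < n < 2 ^ (4 ^ k.+1))%N ->
  (forall p, (p <= 2 ^ k)%N -> logn p m = logn p n) -> 0 < D m -> 0 < D n ->
  overlap D m n <= 8 * expR 25 * (D m * (totient m)%:R) * (D n * (totient n)%:R)
       + (m == n)%:R * (2 * (D n * (totient n)%:R)).
Proof.
move=> k_gt0 m_b n_b vals Dm Dn.
have [m1 n1] : (1 < m)%N /\ (1 < n)%N by case/andP: m_b; case/andP: n_b.
have [m_gt0 n_gt0] : (0 < m)%N /\ (0 < n)%N by split; exact: ltnW.
have [mR nR] : 0 < m%:R :> R /\ 0 < n%:R :> R by rewrite !ltr0n.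
pose M := Num.max (D m) (D n); pose mu := Num.min (D m) (D n).
have M0 : 0 <= M by rewrite le_max ltW.
have mu0 : 0 <= mu by rewrite le_min !ltW.
have vals' p : (p <= 2 ^ k)%N -> logn p n = logn p m by move=> /vals.
have H1 := sum_close_pairs k_gt0 m_b n_b vals M0.
have H2 := sum_close_pairs k_gt0 n_b m_b vals' M0.
set S1 := \sum_(_ <= _ < _ | _) _ in H1; set S2 := \sum_(_ <= _ < _ | _) _ in H2.
pose S3 : R := \sum_(1 <= a < m.+1 | coprime a m) \sum_(1 <= b < n.+1 | coprime b n)
   ((m == n) && (a == b))%:R.
have S3E : S3 <= (m == n)%:R * (totient n)%:R.
  rewrite /S3; case: eqP => [->|_] /=; last first.
    by rewrite mul0r big1 // => a _; rewrite big1.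
  rewrite mul1r -count_coprime //; apply: ler_sum => a am.
  rewrite big_mkcond; have [a_in|a_out] := boolP (a \in index_iota 1 n.+1).
    rewrite (bigD1_seq a) ?iota_uniq //= am eqxx big1 ?addr0 // => b ba.
    by rewrite eq_sym (negbTE ba); case: ifP.
  rewrite big_seq big1 ?ler01 // => b b_in; case: eqP => [ab|_]; last by case: ifP.
  by rewrite ab b_in in a_out.
have muM : mu * M = D m * D n by rewrite /mu /M; case: leP => _ //; rewrite mulrC.
have total : overlap D m n <= 2 * mu * S1 + 2 * mu * S2 + 2 * mu * S3.
  rewrite /S2 exchange_big /= !mulr_sumr -!big_split; apply: ler_sum => a am /=.
  rewrite !mulr_sumr -!big_split; apply: ler_sum => b bn /=.
  apply: le_trans (unit_measure_approx_itvI a b Dm Dn) _.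
  rewrite -/M -/mu -!mulrDr ler_wpM2l ?mulr_ge0 //.
  case: ltP => // close; last by rewrite !addr_ge0.
  move: close; rewrite ltr_norml => /andP[c1 c2].
  have [lt_ab|lt_ba|eq_ab] := ltngtP (b * m)%N (a * n)%N.
  - by rewrite c2 /= -addrA lerDl addr_ge0.
  - have -> /= : b%:R / n%:R - a%:R / m%:R < 2 * M by lra.
    by rewrite add0r lerDl.
  - have [-> ->] := reduced_eq m_gt0 n_gt0 am bn (esym eq_ab).
    by rewrite !eqxx /= lerDr addr_ge0.
apply: le_trans total _; apply: lerD.
  have {}H1 := ler_wpM2l (mulr_ge0 (ler0n R 2) mu0) H1.
  have {}H2 := ler_wpM2l (mulr_ge0 (ler0n R 2) mu0) H2.
  apply: le_trans (lerD H1 H2) _; rewrite le_eqVlt; apply/orP; left; apply/eqP.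
  rewrite [RHS](_ : _ = 8 * expR 25 * (totient m)%:R * (totient n)%:R * (D m * D n)).
    by rewrite -muM; ring.
  by ring.
apply: le_trans (ler_wpM2l (mulr_ge0 (ler0n R 2) mu0) S3E) _.
have muD : mu <= D n by rewrite ge_min lexx orbT.
rewrite [leLHS](_ : _ = mu * (2 * ((m == n)%:R * (totient n)%:R))); last by ring.
rewrite [leRHS](_ : _ = D n * (2 * ((m == n)%:R * (totient n)%:R))); last by ring.
by rewrite ler_wpM2r // !mulr_ge0.
Qed.

(** * Scales and classes *)

Definition scale (n : nat) : nat := trunc_log 4 (trunc_log 2 n).

Lemma scale_bounds (n : nat) : (1 < n)%N ->
  (2 ^ (4 ^ scale n) <= n < 2 ^ (4 ^ (scale n).+1))%N.
Proof.
move=> n1; have n0 : (0 < n)%N by exact: ltnW.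
have t0 : (0 < trunc_log 2 n)%N by rewrite trunc_log_gt0.
have /andP[lo hi] := trunc_log_bounds (isT : (1 < 2)%N) n0.
have /andP[lo4 hi4] := trunc_log_bounds (isT : (1 < 4)%N) t0.
apply/andP; split; first by rewrite (leq_trans _ lo) // leq_exp2l.
by rewrite (leq_trans hi) // leq_exp2l.
Qed.

(** The number of values of [valuation_class k]: one valuation, at most [4 ^ k.+1], for each index
    up to [2 ^ k], prime or not. *)
Definition nb_classes (k : nat) : nat := ((4 ^ k.+1).+1 ^ (2 ^ k).+1)%N.

Lemma nb_classes_le (k : nat) : (nb_classes k <= 2 ^ ((2 * k + 3) * 2 ^ k.+1))%N.
Proof.
apply: leq_trans (_ : ((2 ^ (2 * k + 3)) ^ (2 ^ k).+1 <= _)%N).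
  rewrite /nb_classes leq_exp2r //.
  have -> : (2 * k + 3 = (2 * k.+1).+1)%N by lia.
  rewrite (expnS 2 (2 * k.+1)) expnM -[(2 ^ 2)%N]/4%N mul2n -addnn -addn1 leq_add2l.
  by rewrite expn_gt0.
rewrite -expnM leq_exp2l // leq_mul2l; apply/orP; right.
by rewrite expnS mul2n -addnn -addn1 leq_add2l expn_gt0.
Qed.

(** The threshold 14 comes from [32 * 16 * 31 = 15872], just below [2 ^ 14 = 16384]. *)
Lemma poly_le_exp2 (k : nat) : (14 <= k)%N -> (32 * (k + 2) * (2 * k + 3) <= 2 ^ k)%N.
Proof.
move=> /subnK <-; elim: (k - 14)%N => [|j IH].
  rewrite add0n; have -> : (2 ^ 14 = 2 ^ 5 * 2 ^ 4 * 2 ^ 5)%N by rewrite -!expnD.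
  exact: leq_mul.
by rewrite addSn expnS; apply: leq_trans (leq_mul (leqnn 2) IH); lia.
Qed.

Lemma ln2_bounds (R : realType) : 2^-1 <= ln 2 :> R /\ ln 2 <= 1 :> R.
Proof.
split; last by have := @le_ln1Dx R 1; rewrite (_ : 1 + 1 = 2); [apply; lra|ring].
have := @le_ln1Dx R (- 2^-1); rewrite (_ : 1 + - 2^-1 = 2^-1); last by field.
by rewrite lnV ?posrE //; lra.
Qed.

(** The exponent in [weight] is nonpositive in this range; at [- ln x = 1] it is a division by zero,
    hence 0. *)
Lemma weight_le (R : realType) (x : R) : 0 <= x -> 1 <= - ln x -> weight x <= x.
Proof.
move=> x0 Lx; rewrite /weight; case: eqP => [->//|/eqP x_neq0].
have x_gt0 : 0 < x by rewrite lt_def x_neq0.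
have x1 : x < 1.
  by rewrite ltNge; apply/negP => /ln_ge0; lra.
rewrite x1 ger_pMr // -[leRHS]expR0 ler_expR.
by rewrite mulr_le0_ge0 ?invr_ge0 ?mulr_ge0 ?ln_ge0 //; lra.
Qed.

(** With [K = 4 ^ k], the two bounds on [x] put [L = - ln x] between [K / 4] and [16 * K], so
    [ln L <= 2 * (k + 2)]. The factor [expR (- L / (2 * ln L))] lost in the weight then beats
    [nb_classes k <= expR N] with [N = (2 * k + 3) * 2 ^ k.+1], by [poly_le_exp2]. *)
Lemma weight_le_nb_classes (R : realType) (k n : nat) (x : R) : (14 <= k)%N ->
  (2 ^ (4 ^ k) <= n < 2 ^ (4 ^ k.+1))%N -> n%:R ^- 3 <= x -> x ^+ 2 * n%:R < 1 ->
  weight x <= x / (nb_classes k)%:R.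
Proof.
move=> k14 /andP[n_ge n_lt] xn x2n.
have n_gt0 : (0 < n)%N by apply: leq_trans n_ge; rewrite expn_gt0.
have nR : 0 < n%:R :> R by rewrite ltr0n.
have x0 : 0 < x by apply: lt_le_trans xn; rewrite invr_gt0 exprn_gt0.
have [l2 l2'] := ln2_bounds R.
pose L := - ln x; pose K : R := (4 ^ k)%:R.
have K1 : 1 <= K by rewrite ler1n expn_gt0.
have ln_n_ge : K / 2 <= ln n%:R.
  have : ln (2 ^ (4 ^ k))%:R <= ln n%:R :> R.
    by rewrite ler_ln ?posrE ?ltr0n ?expn_gt0 // ler_nat.
  by rewrite natrX lnXn // -[ln 2 *+ _]mulr_natl -/K; nra.
have ln_n_le : ln n%:R <= 4 * K.
  have : ln n%:R <= ln (2 ^ (4 ^ k.+1))%:R :> R.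
    by rewrite ler_ln ?posrE ?ltr0n ?expn_gt0 // ler_nat ltnW.
  by rewrite natrX lnXn // -[ln 2 *+ _]mulr_natl expnS natrM -/K; nra.
have L_ge : K / 4 <= L.
  have : ln (x ^+ 2 * n%:R) <= 0 by rewrite ln_le0 // ltW.
  by rewrite lnM ?posrE ?exprn_gt0 // lnXn // mulr2n /L; lra.
have L_le : L <= 16 * K.
  have : ln (n%:R ^- 3) <= ln x by rewrite ler_ln ?posrE // invr_gt0 exprn_gt0.
  by rewrite lnV ?posrE ?exprn_gt0 // lnXn // !mulrS mulr0n /L; lra.
have K16 : 16 <= K.
  have -> : 16 = (4 ^ 2)%:R :> R by [].
  by rewrite ler_nat leq_exp2l // (leq_trans _ k14).
have L_gt1 : 1 < L by lra.
have lnL0 : 0 < ln L by rewrite ln_gt0.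
have lnL : ln L <= (k + 2)%:R * 2.
  apply: le_trans (_ : ln (4 ^ (k + 2))%:R <= _).
    rewrite ler_ln ?posrE ?ltr0n ?expn_gt0 //; last lra.
    by rewrite expnD natrM -/K -[(4 ^ 2)%N]/16%N; lra.
  have -> : (4 ^ (k + 2))%:R = 2 ^+ (2 * (k + 2)) :> R.
    by rewrite exprM natrX; congr (_ ^+ _); ring.
  rewrite lnXn // -[ln 2 *+ _]mulr_natl natrM [2 * _]mulrC.
  by rewrite ler_piMr // mulr_ge0.
pose N : R := ((2 * k + 3) * 2 ^ k.+1)%:R.
have N0 : 0 <= N by [].
have NL : N * (2 * ln L) <= L.
  apply: le_trans (_ : N * (2 * ((k + 2)%:R * 2)) <= _).
    by rewrite ler_wpM2l // ler_wpM2l.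
  apply: le_trans L_ge; rewrite ler_pdivlMr //.
  have -> : N * (2 * ((k + 2)%:R * 2)) * 4 = ((32 * (k + 2) * (2 * k + 3)) * 2 ^ k)%:R :> R.
    by rewrite /N expnS !natrM; ring.
  rewrite /K ler_nat.
  have -> : (4 ^ k = 2 ^ k * 2 ^ k)%N by rewrite -expnMn.
  by rewrite leq_mul2r poly_le_exp2 // orbT.
have x1 : x < 1 by rewrite ltNge; apply/negP => /ln_ge0; rewrite /L in L_gt1 *; lra.
rewrite /weight gt_eqF // x1 ler_pM2l // -/L.
have cls : (nb_classes k)%:R <= expR N.
  apply: le_trans (_ : (2 ^ ((2 * k + 3) * 2 ^ k.+1))%:R <= _).
    by rewrite ler_nat nb_classes_le.
  rewrite natrX /N -[X in expR X]mulr1 expRM_natl; apply: lerXn2r; rewrite ?nnegrE ?expR_ge0 //.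
  by have := @expR_ge1Dx R 1; lra.
have cls0 : 0 < (nb_classes k)%:R :> R by rewrite ltr0n expn_gt0.
apply: le_trans (_ : expR (- N) <= _); last first.
  by rewrite expRN lef_pV2 ?posrE ?expR_gt0.
rewrite ler_expR -[ln x]opprK -/L mulNr lerN2 ler_pdivlMr //.
by rewrite mulr_gt0.
Qed.

(** [inord] returns a default value on arguments out of range; valuations of positive
    [n < 2 ^ (4 ^ k.+1)] stay in range. *)
Definition valuation_class (k n : nat) : {ffun 'I_(2 ^ k).+1 -> 'I_(4 ^ k.+1).+1} :=
  [ffun p => inord (logn (nat_of_ord p) n)].

Lemma valuation_classP (k m n : nat) : (0 < m < 2 ^ (4 ^ k.+1))%N ->
  (0 < n < 2 ^ (4 ^ k.+1))%N -> valuation_class k m = valuation_class k n ->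
  forall p, (p <= 2 ^ k)%N -> logn p m = logn p n.
Proof.
move=> m_b n_b mn p pk.
have logn_lt j : (0 < j < 2 ^ (4 ^ k.+1))%N -> (logn p j < (4 ^ k.+1).+1)%N.
  move=> /andP[j0 j_lt]; have [->//|] := posnP (logn p j).
  rewrite logn_gt0 mem_primes => /andP[p_pr _]; rewrite ltnS ltnW //.
  rewrite -(@ltn_exp2l 2) // (leq_ltn_trans _ j_lt) //.
  apply: leq_trans (dvdn_leq j0 (pfactor_dvdnn p j)).
  by case: (logn p j) => [|e]; [rewrite !expn0|rewrite leq_exp2r // prime_gt1].
have := congr1 (fun f : {ffun _} => nat_of_ord (f (Ordinal (pk : p < (2 ^ k).+1)%N))) mn.
by rewrite !ffunE /= !inordK ?logn_lt.
Qed.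

(** Pigeonhole: [kappa] is a class with the largest sum. *)
Lemma best_class (R : realType) (k : nat) (s : seq nat) (P : pred nat) (h : nat -> R) :
  exists kappa, \sum_(n <- s | P n) h n <=
    (nb_classes k)%:R * \sum_(n <- s | P n && (valuation_class k n == kappa)) h n.
Proof.
pose F kappa := \sum_(n <- s | P n && (valuation_class k n == kappa)) h n.
have [kappa _ max_kappa] := @Order.TotalTheory.arg_maxP _ R _ (valuation_class k 0) xpredT F isT.
exists kappa; rewrite (partition_big (valuation_class k) xpredT) //=.
apply: le_trans (_ : \sum_(kappa' : {ffun 'I_(2 ^ k).+1 -> 'I_(4 ^ k.+1).+1}) F kappa <= _).
  by apply: ler_sum => kappa' _; exact: max_kappa.
by rewrite sumr_const card_ffun !card_ord mulr_natl.
Qed.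

Lemma scale_partition (R : realType) (K : nat) (P : pred nat) (f : nat -> R) :
  (forall n, P n -> (1 < n)%N) ->
  \sum_(0 <= n < 2 ^ (4 ^ K.+1) | P n) f n =
  \sum_(0 <= k < K.+1) \sum_(0 <= n < 2 ^ (4 ^ k.+1) | P n && (scale n == k)) f n.
Proof.
move=> P1.
have -> : \sum_(0 <= k < K.+1) \sum_(0 <= n < 2 ^ (4 ^ k.+1) | P n && (scale n == k)) f n =
    \sum_(0 <= k < K.+1) \sum_(0 <= n < 2 ^ (4 ^ K.+1)) (if P n && (scale n == k) then f n else 0).
  rewrite big_nat_cond [RHS]big_nat_cond; apply: eq_bigr => k /andP[/andP[_ kK] _].
  rewrite (@big_nat_widen _ _ _ 0 (2 ^ (4 ^ k.+1)) (2 ^ (4 ^ K.+1))); last first.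
    by rewrite !leq_exp2l.
  rewrite -big_mkcond; apply: eq_bigl => n.
  case: (boolP (P n)) => //= Pn; case: eqP => //= sn.
  by have /andP[_] := scale_bounds (P1 n Pn); rewrite sn.
rewrite exchange_big /= big_mkcond big_nat [RHS]big_nat; apply: eq_bigr => n /andP[_ nK].
case: (boolP (P n)) => /= Pn; last by rewrite big1.
have sK : (scale n < K.+1)%N.
  have /andP[n_ge _] := scale_bounds (P1 n Pn).
  have := leq_ltn_trans n_ge nK; rewrite ltn_exp2l // ltn_exp2l //.
rewrite (bigD1_seq (scale n)) ?iota_uniq ?mem_index_iota //= eqxx big1 ?addr0 // => k ks.
by rewrite eq_sym (negbTE ks).
Qed.

Lemma sum_inv_le1 (R : realType) (m X : nat) : (1 < m)%N ->
  \sum_(m <= n < X) (n%:R * (n%:R - 1))^-1 <= 1 :> R.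
Proof.
move=> m1; have F0 (n : nat) : 0 <= (n%:R * (n%:R - 1))^-1 :> R.
  by case: n => [|n]; rewrite ?mul0r ?invr0 // invr_ge0 mulr_ge0 // subr_ge0 ler1n.
apply: le_trans (_ : \sum_(2 <= n < X.+2) (n%:R * (n%:R - 1))^-1 <= _).
  apply: ler_sum_subset; rewrite ?iota_uniq // => n; rewrite !mem_index_iota.
  by move=> /andP[mn nX]; rewrite (leq_trans m1 mn) ltnW // ltnW.
by rewrite sum_inv_consecutive lerBlDr lerDl invr_ge0.
Qed.

(** For [x >= n ^ -3] the weight gains the factor [1 / nb_classes]; for smaller [x] the term is at
    most [n ^ -2], which a telescoping series dominates. *)
Lemma weight_totient_le (R : realType) (n : nat) (x : R) : (14 <= scale n)%N ->
  (1 < n)%N -> 0 <= x -> x ^+ 2 * n%:R < 1 ->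
  weight x * (totient n)%:R <= (n%:R * (n%:R - 1))^-1 +
    (if n%:R ^- 3 <= x then x * (totient n)%:R / (nb_classes (scale n))%:R else 0).
Proof.
move=> n14 n1 x0 x2n.
have nR : 2 <= n%:R :> R by rewrite ler_nat.
have nn0 : 0 <= (n%:R * (n%:R - 1))^-1 :> R by rewrite invr_ge0 mulr_ge0 //; lra.
have phi0 : 0 <= (totient n)%:R :> R by [].
have [large|small] := leP (n%:R ^- 3) x.
  have := weight_le_nb_classes n14 (scale_bounds n1) large x2n.
  by move=> /(ler_wpM2r phi0); rewrite mulrAC => /le_trans; apply; rewrite lerDr.
rewrite addr0; have wx : weight x <= x.
  have [->|x_neq0] := eqVneq x 0; first by rewrite /weight eqxx.
  have x_gt0 : 0 < x by rewrite lt_def x_neq0.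
  apply: weight_le => //.
  have : ln x <= ln (n%:R ^- 3).
    by rewrite ler_ln ?posrE ?invr_gt0 ?exprn_gt0 ?ltW //; lra.
  have n_gt0 : 0 < n%:R :> R by lra.
  rewrite lnV ?posrE ?exprn_gt0 // lnXn // !mulrS mulr0n.
  have : ln 2 <= ln n%:R :> R by rewrite ler_ln ?posrE.
  have [l2 _] := ln2_bounds R; lra.
apply: le_trans (ler_wpM2r phi0 wx) _.
have phin : (totient n)%:R <= n%:R :> R.
  rewrite totient_prod ?(ltnW n1) // ler_piMr //.
  by have /andP[] := primes_prod_ge0 R n.
apply: le_trans (_ : n%:R ^- 3 * n%:R <= _); first by rewrite ler_pM // ltW.
have -> : n%:R ^- 3 * n%:R = (n%:R * n%:R)^-1 :> R by field; apply: lt0r_neq0; lra.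
rewrite lef_pV2 ?posrE ?mulr_gt0 ?ler_wpM2l //; lra.
Qed.

Lemma scale_ge (k n : nat) : (2 ^ (4 ^ k) <= n)%N -> (k <= scale n)%N.
Proof. by move=> kn; apply: trunc_log_max => //; exact: trunc_log_max. Qed.

Lemma sum_split_unbounded (R : realType) (P Q : pred nat) (h : nat -> R) :
  (forall n, P n -> 0 <= h n) ->
  (forall B, exists X, B <= \sum_(0 <= n < X | P n) h n) ->
  exists b, forall K B, exists X, B <= \sum_(K <= n < X | P n && (Q n == b)) h n.
Proof.
move=> h0 div; apply: contrapT => /forallNP bdd.
have bound b : exists B, forall X, \sum_(0 <= n < X | P n && (Q n == b)) h n <= B.
  have /existsNP[K /existsNP[B /forallNP H]] := bdd b.
  exists (\sum_(0 <= n < K | P n && (Q n == b)) h n + B) => X.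
  have HX := H X; move/negP: HX; rewrite -ltNge => HX.
  have [XK|KX] := leqP X K.
    have HK := H K; move/negP: HK; rewrite -ltNge big_geq // => B0.
    rewrite (@big_cat_nat _ _ _ X 0 K) //= -addrA lerDl addr_ge0 ?(ltW B0) //.
    by apply: sumr_ge0 => n /andP[/h0].
  by rewrite (@big_cat_nat _ _ _ K 0 X) ?(ltnW KX) //= lerD2l ltW.
have [Bt Ht] := bound true; have [Bf Hf] := bound false.
have [X] := div (Bt + Bf + 1).
rewrite (bigID Q) /=.
have -> : \sum_(0 <= n < X | P n && Q n) h n = \sum_(0 <= n < X | P n && (Q n == true)) h n.
  by apply: eq_bigl => n; rewrite eqb_id.
have -> : \sum_(0 <= n < X | P n && ~~ Q n) h n =
    \sum_(0 <= n < X | P n && (Q n == false)) h n.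
  by apply: eq_bigl => n; rewrite eqbF_neg.
have := Ht X; have := Hf X; lra.
Qed.

(** In each scale the richest class carries at least the share [1 / nb_classes] of the sum of
    [D n * totient n], and this share bounds the sum of the weights up to a convergent series. One
    parity of scales then keeps the divergence. *)
Lemma selection (R : realType) (D : nat -> R) (n0 : nat) :
  (1 < n0)%N -> (forall n, (n0 <= n)%N -> 14 <= scale n)%N ->
  (forall n, (n0 <= n)%N -> 0 <= D n /\ D n ^+ 2 * n%:R < 1) ->
  (forall B, exists X, B <= \sum_(n0 <= n < X) weight (D n) * (totient n)%:R) ->
  exists A : pred nat,
    [/\ forall n, A n -> (n0 <= n)%N /\ n%:R ^- 3 <= D n,
        forall m n, A m -> A n -> scale m = scale n ->
          valuation_class (scale n) m = valuation_class (scale n) n,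
        forall m n, A m -> A n -> odd (scale m) = odd (scale n) &
        forall K B, exists X, B <= \sum_(K <= n < X | A n) D n * (totient n)%:R].
Proof.
move=> n0_gt1 n0_scale DP div.
pose h n := D n * (totient n)%:R.
pose good n := (n0 <= n)%N && (n%:R ^- 3 <= D n).
pose sel k := best_class k (index_iota 0 (2 ^ (4 ^ k.+1))) (fun n => good n && (scale n == k)) h.
pose kappa k := sval (cid (sel k)).
have kappaP k : \sum_(0 <= n < 2 ^ (4 ^ k.+1) | good n && (scale n == k)) h n <=
    (nb_classes k)%:R * \sum_(0 <= n < 2 ^ (4 ^ k.+1) |
       (good n && (scale n == k)) && (valuation_class k n == kappa k)) h n.
  exact: (svalP (cid (sel k))).
pose A0 n := good n && (valuation_class (scale n) n == kappa (scale n)).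
have good_gt1 n : good n -> (1 < n)%N by case/andP=> n0n _; exact: leq_trans n0n.
have h0 n : good n -> 0 <= h n.
  by case/andP=> n0n _; have [D0 _] := DP n n0n; exact: mulr_ge0.
have div0 B : exists X, B <= \sum_(0 <= n < X | A0 n) h n.
  (* The extra 1 pays for the telescoping series in [weight_totient_le]. The new end point lies
     beyond [X] and closes a scale, so that only whole scales are summed. *)
  have [X HX] := div (B + 1); exists (2 ^ (4 ^ X.+1))%N.
  have XX : (X <= 2 ^ (4 ^ X.+1))%N.
    rewrite ltnW // (leq_trans (ltn_expl X (isT : 1 < 4)%N)) //.
    rewrite ltnW // (leq_trans (ltn_expl _ (isT : 1 < 2)%N)) //.
    by rewrite leq_exp2l // leq_exp2l.
  have t_le : \sum_(n0 <= n < X) weight (D n) * (totient n)%:R <=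
     1 + \sum_(0 <= n < 2 ^ (4 ^ X.+1) | good n) h n / (nb_classes (scale n))%:R.
    apply: le_trans (_ : \sum_(n0 <= n < X) ((n%:R * (n%:R - 1))^-1 +
       (if n%:R ^- 3 <= D n then h n / (nb_classes (scale n))%:R else 0)) <= _).
      rewrite big_nat [leRHS]big_nat; apply: ler_sum => n /andP[n0n _].
      have [D0 D2] := DP n n0n.
      by apply: weight_totient_le => //; [exact: n0_scale|exact: leq_trans n0n].
    rewrite big_split /=; apply: lerD; first exact: sum_inv_le1.
    rewrite -big_mkcond /= -big_filter -[leRHS]big_filter.
    rewrite [leLHS](_ : _ = \sum_(n <- [seq n <- index_iota n0 X | n%:R ^- 3 <= D n])
      (if good n then h n / (nb_classes (scale n))%:R else 0)); last first.
      rewrite big_seq [RHS]big_seq; apply: eq_bigr => n.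
      by rewrite mem_filter mem_index_iota /good => /andP[-> /andP[->]].
    rewrite [leRHS](_ : _ = \sum_(n <- [seq n <- index_iota 0 (2 ^ (4 ^ X.+1)) | good n])
      (if good n then h n / (nb_classes (scale n))%:R else 0)); last first.
      rewrite big_seq [RHS]big_seq; apply: eq_bigr => n.
      by rewrite mem_filter => /andP[->].
    apply: ler_sum_subset; rewrite ?filter_uniq ?iota_uniq //.
      move=> n; rewrite !mem_filter !mem_index_iota => /andP[Dn /andP[n0n nX]].
      by rewrite /good n0n Dn (leq_trans nX).
    by move=> n; case: ifP => // /h0 hn; rewrite divr_ge0.
  suff : \sum_(0 <= n < 2 ^ (4 ^ X.+1) | good n) h n / (nb_classes (scale n))%:R <=
    \sum_(0 <= n < 2 ^ (4 ^ X.+1) | A0 n) h n by lra.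
  rewrite (scale_partition X _ good_gt1).
  rewrite (scale_partition X (P := A0)); last by move=> n /andP[/good_gt1].
  apply: ler_sum => k _.
  have nb0 : 0 < (nb_classes k)%:R :> R by rewrite ltr0n expn_gt0.
  rewrite [leLHS](_ : _ = (\sum_(0 <= n < 2 ^ (4 ^ k.+1) | good n && (scale n == k)) h n)
     / (nb_classes k)%:R); last first.
    by rewrite mulr_suml; apply: eq_bigr => n /andP[_ /eqP ->].
  rewrite ler_pdivrMr // mulrC; apply: le_trans (kappaP k) _.
  rewrite le_eqVlt; apply/orP; left; apply/eqP; congr (_ * _); apply: eq_bigl => n.
  by rewrite /A0; case: eqP => [->|_]; rewrite ?andbF ?andbT.
have [b Hb] := sum_split_unbounded (fun n => odd (scale n))
  (fun n An => h0 n (proj1 (andP An))) div0.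
exists (fun n => A0 n && (odd (scale n) == b)); split=> //.
- by move=> n /andP[/andP[/andP[]]].
- move=> m n /andP[/andP[_ /eqP mk] _] /andP[/andP[_ /eqP nk] _] mn.
  by rewrite nk -mn mk.
- by move=> m n /andP[_ /eqP ->] /andP[_ /eqP ->].
Qed.

(** * The circle *)

Lemma to_circleP (R : realType) (x y : R) :
  to_circle x = to_circle y <-> x - y \is a Num.int.
Proof. by split=> [/eqmodP|?]; last exact/eqmodP. Qed.

(** The preimage in the real line is a union of integer translates of open intervals, hence open. *)
Lemma measurable_approx_set (R : realType) (psi : nat -> R) (n : nat) :
  measurable (approx_set psi n).
Proof.
suff : measurable ((@to_circle R) @^-1` approx_set psi n) by [].
have -> : (@to_circle R) @^-1` approx_set psi n =
  \bigcup_(a in [set a : nat | (1 <= a <= n)%N && coprime a n])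
   \bigcup_(z in [set z : R | z \is a Num.int])
    `](a%:R - psi n) / n%:R + z, (a%:R + psi n) / n%:R + z[%classic.
  apply/seteqP; split=> y.
    move=> [a a_ok [x x_in /to_circleP xy]]; exists a => //.
    exists (y - x); first by rewrite /= -opprB rpredN.
    by move: x_in; rewrite /= !in_itv /= => /andP[lo hi]; apply/andP; split; lra.
  move=> [a a_ok [z z_int y_in]]; exists a => //; exists (y - z).
    by move: y_in; rewrite /= !in_itv /= => /andP[lo hi]; apply/andP; split; lra.
  by apply/to_circleP; rewrite addrAC subrr add0r rpredN.
apply: open_measurable; apply: bigcup_open => a _; apply: bigcup_open => z _.
exact: itv_open.
Qed.

Lemma measurable_limsup_approx (R : realType) (psi : nat -> R) :
  measurable (limsup_approx psi).
Proof.
apply: bigcapT_measurable => N; apply: bigcup_measurable => n _.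
exact: measurable_approx_set.
Qed.

(** The hypothesis makes the complement of each tail union [T N] null, and the complement of the
    limsup set is the countable union of these. [A] may vary with [N] and [e]. *)
Lemma circle_full_of_cover (R : realType) (psi : nat -> R) (N0 : nat) :
  (forall (N : nat) (e : R), (N0 <= N)%N -> 0 < e -> exists M A,
    unit_measure (`[0, 1]%classic `\` approx_union A (fun n => psi n / n%:R) N M) <= e) ->
  circle_measure (limsup_approx psi) = 1%E.
Proof.
move=> cover.
pose T N := \bigcup_(n in [set n | (N <= n)%N]) approx_set psi n.
have mT N : measurable (T N).
  by apply: bigcup_measurable => n _; exact: measurable_approx_set.
have mU A N M := measurable_approx_union A (fun n => psi n / n%:R) N M.
have T0 N : (N0 <= N)%N -> circle_measure (~` T N) = 0%E.
  move=> N0N; apply/eqP; rewrite eq_le measure_ge0 andbT.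
  apply/lee_addgt0Pr => e e0; rewrite add0e.
  have [M [A HM]] := cover N e N0N e0.
  apply: le_trans (_ : (unit_measure (`[0, 1]%classic `\`
     approx_union A (fun n => psi n / n%:R) N M))%:E <= _)%E; last by rewrite lee_fin.
  rewrite -unit_measureE; last exact: measurableD.
  have mC : measurable ((@to_circle R) @^-1` (~` T N)) by exact: (measurableC (mT N)).
  rewrite /circle_measure /pushforward /mrestr; apply: le_measure.
  - by rewrite inE; apply: measurableI mC (measurable_itv _).
  - rewrite inE; apply: measurableI; first exact: measurable_itv.
    by apply: measurableD (mU A N M); exact: measurable_itv.
  move=> x [xT]; rewrite /= in_itv /= => /andP[x0 x1].
  have x01 : x \in `[0, 1] by rewrite in_itv /= x0 ltW.
  split=> //; split=> // /approx_unionP[n [a [_ /andP[Nn _] an cop xJ]]].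
  apply: xT; exists n => //; exists a; first by rewrite /= an cop.
  exists x => //; move: xJ; rewrite /approx_itv /= !in_itv /=.
  by rewrite !mulrDl mulNr.
(* Below [N0], use that [T] is nonincreasing. *)
have TN N : circle_measure (~` T N) = 0%E.
  apply/eqP; rewrite eq_le measure_ge0 andbT -(T0 (maxn N0 N) (leq_maxl _ _)).
  apply: le_measure; rewrite ?inE; try exact: measurableC.
  apply: subsetC => y [n /= Nn yn]; exists n => //=.
  by apply: leq_trans Nn; exact: leq_maxr.
have mW := measurable_limsup_approx psi.
have W0 : circle_measure (~` limsup_approx psi) = 0%E.
  apply: measure_negligible; first exact: measurableC.
  rewrite /limsup_approx /lim_sup_set setC_bigcap; apply: negligible_bigcup => N.
  by exists (~` T N); split=> [| |x //]; [exact: measurableC|exact: TN].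
have E : circle_measure (~` limsup_approx psi) = (1 - circle_measure (limsup_approx psi))%E.
  exact: (probability_setC _ mW).
rewrite W0 in E.
have fin : circle_measure (limsup_approx psi) \is a fin_num by exact: fin_num_measure.
move: E fin; case: (circle_measure _) => [x| |] //= E _.
have {}E : 0 = 1 - x by apply: EFin_inj.
by have -> : x = 1 by lra.
Qed.

(** An interval of length [r / 2] next to [x] contains a reduced [a / n] as soon as
    [totient n * r > 6 * w]. If this failed, [1 <= r ^ 2 * n] and [n <= totient n * w] would give
    [n <= 36 * w ^ 4], against [37 * w ^ 8 <= n]. *)
Lemma approx_union_full (R : realType) : exists N0 : nat,
  forall (D : nat -> R) (n : nat), (N0 <= n)%N -> 0 <= D n -> 1 <= D n ^+ 2 * n%:R ->
  `[0, 1]%classic `<=` approx_union predT D n n.+1.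
Proof.
have [N0 HN0] := omega_small 37; exists (maxn N0 4) => D n.
rewrite geq_max => /andP[N0n n4] D0 D2 x /=; rewrite in_itv /= => /andP[x0 x1].
have n_gt0 : (0 < n)%N by apply: leq_trans n4.
have nR : 4 <= n%:R :> R by rewrite ler_nat.
pose r := Num.min (D n) 2^-1.
have rD : r <= D n by rewrite ge_min lexx.
have r2 : r <= 2^-1 by rewrite ge_min lexx orbT.
have r0 : 0 <= r by rewrite le_min D0 invr_ge0 ler0n.
have rn : 1 <= r ^+ 2 * n%:R.
  rewrite /r; case: (leP (D n) 2^-1) => _ //.
  have -> : (2^-1 : R) ^+ 2 * n%:R = n%:R / 4 by field.
  lra.
have r_gt0 : 0 < r.
  by rewrite lt_def r0 andbT; apply/eqP => r_eq0; move: rn; rewrite r_eq0 expr0n /= mul0r; lra.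
set phi : R := (totient n)%:R.
set w : R := 2 ^+ size (primes n).
have w1 : 1 <= w by rewrite exprn_ege1 // ler1n.
have phiw : n%:R <= phi * w by rewrite /phi /w -natrX -natrM ler_nat totient_lower.
have w8 : 37 * w ^+ 8 <= n%:R.
  by rewrite /w -!natrX -natrM ler_nat HN0.
have phi0 : 0 <= phi by [].
have big : 6 * w < phi * r.
  rewrite ltNge; apply/negP => small.
  have sq : (phi * r) ^+ 2 <= (6 * w) ^+ 2 by rewrite ler_sqr ?nnegrE ?mulr_ge0 //; lra.
  have nn : n%:R ^+ 2 <= (phi * w) ^+ 2 by rewrite ler_sqr ?nnegrE ?mulr_ge0 //; lra.
  have H1 : n%:R ^+ 2 <= ((phi * r) ^+ 2 * w ^+ 2) * n%:R.
    apply: le_trans nn _; have -> : (phi * r) ^+ 2 * w ^+ 2 * n%:R =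
       (phi * w) ^+ 2 * (r ^+ 2 * n%:R) by ring.
    by rewrite ler_peMr // sqr_ge0.
  have H2 : n%:R <= (phi * r) ^+ 2 * w ^+ 2.
    by move: H1; rewrite expr2 ler_pM2r //; lra.
  have H3 : (phi * r) ^+ 2 * w ^+ 2 <= 36 * w ^+ 4.
    have -> : 36 * w ^+ 4 = (6 * w) ^+ 2 * w ^+ 2 by ring.
    by rewrite ler_wpM2r // sqr_ge0.
  have w4 : w ^+ 4 <= w ^+ 8 by rewrite ler_weXn2l.
  have w40 : 0 < w ^+ 4 by rewrite exprn_gt0 //; lra.
  lra.
(* The interval ends at [x], or starts at 0 when [x] is too close to 0; the cap [r <= 1/2] keeps it
   inside [0, 1]. *)
pose u := Num.max (x - r / 2) 0; pose v := u + r / 2.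
have u0 : 0 <= u by rewrite le_max lexx orbT.
have uv : u <= v by rewrite /v; lra.
have v1 : v <= 1 by rewrite /v /u; case: (leP (x - r / 2) 0); lra.
have := coprime_count_lower n_gt0 u0 uv v1; rewrite -/phi -/w => cnt.
have : 0 < \sum_(1 <= a < n.+1 | coprime a n && (u < a%:R / n%:R <= v)) (1 : R).
  apply: lt_le_trans cnt; rewrite /v; have -> : u + r / 2 - u = r / 2 by ring.
  lra.
move=> pos; apply: contrapT => no; move: pos; rewrite big_nat_cond big1 ?ltxx // => a.
move=> /andP[/andP[a1 an] /andP[cop /andP[ua av]]]; case: no.
apply/approx_unionP; exists n, a; split=> //; first by rewrite leqnn ltnSn.
  by rewrite a1.
rewrite /approx_itv /= in_itv /=; move: ua av; rewrite /v /u; case: (leP (x - r / 2) 0) => ? ? ?;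
  by apply/andP; split; lra.
Qed.

(** * From the divergent series to full measure *)

Lemma nneseries_pinfty_unbounded (R : realType) (u : nat -> R) :
  (forall n, (1 <= n)%N -> 0 <= u n) -> (\sum_(1 <= n <oo) (u n)%:E = +oo)%E ->
  forall (m : nat) (B : R), (0 < m)%N -> exists X, B <= \sum_(m <= n < X) u n.
Proof.
move=> u0 Hoo m B m0; apply: contrapT => /forallNP none.
pose c := \sum_(1 <= n < m) u n + Num.max B 0.
suff : (\sum_(1 <= n <oo) (u n)%:E <= c%:E)%E by rewrite Hoo leNgt ltry.
apply: lime_le; first by apply: is_cvg_nneseries => n n1 _; rewrite lee_fin u0.
apply: nearW => X; rewrite sumEFin lee_fin.
have [Xm|mX] := leqP X m.
  have [X1|X1] := leqP X 1.
    by rewrite big_geq // addr_ge0 ?le_max ?lexx ?orbT // big_nat sumr_ge0 // => n /andP[/u0].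
  rewrite /c (@big_cat_nat _ _ _ X 1 m) ?(ltnW X1) //= -addrA lerDl addr_ge0 //.
    by rewrite big_nat sumr_ge0 // => n /andP[Xn _]; apply: u0; apply: leq_trans Xn; exact: ltnW.
  by rewrite le_max lexx orbT.
rewrite (@big_cat_nat _ _ _ m 1 X) ?(ltnW mX) //= lerD2l le_max; apply/orP; left.
by have /negP := none X; rewrite -ltNge => /ltW.
Qed.

Lemma weight_ge0 (R : realType) (x : R) : 0 <= x -> 0 <= weight x.
Proof.
move=> x0; rewrite /weight; case: ifP => // _; case: ifP => // _.
by rewrite mulr_ge0 ?expR_ge0.
Qed.

Lemma scale_large (k : nat) : exists n0, forall n, (n0 <= n)%N -> (k <= scale n)%N.
Proof. by exists (2 ^ (4 ^ k))%N => n; exact: scale_ge. Qed.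

(** This is what skipping a scale buys: [m < 2 ^ (4 ^ (scale m).+1)], and the fourth power of the
    right side is [2 ^ (4 ^ (scale m).+2)]. *)
Lemma pow4_le_of_scale (m n : nat) : (1 < m)%N -> (1 < n)%N ->
  ((scale m).+2 <= scale n)%N -> (m ^ 4 <= n)%N.
Proof.
move=> m1 n1 mn; have /andP[_ m_lt] := scale_bounds m1; have /andP[n_ge _] := scale_bounds n1.
apply: leq_trans n_ge; apply: leq_trans (_ : ((2 ^ (4 ^ (scale m).+1)) ^ 4 <= _)%N).
  by rewrite leq_exp2r // ltnW.
by rewrite -expnM -expnSr leq_exp2l // leq_exp2l.
Qed.

Theorem theorem1 (R : realType) (psi : nat -> R)
    (psi_ge0 : forall n : nat, (0 < n)%N -> 0 <= psi n)
    (sum_infty :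
      (\sum_(1 <= n <oo) (weight (psi n / n%:R) * (totient n)%:R)%:E = +oo)%E) :
  circle_measure (limsup_approx psi) = 1%E.
Proof.
pose D n := psi n / n%:R.
have D0 n : (0 < n)%N -> 0 <= D n by move=> n0; rewrite divr_ge0 // psi_ge0.
have [Nfull Hfull] := approx_union_full R.
have [inf|fin] := pselect (forall N, exists2 n, (N <= n)%N & 1 <= D n ^+ 2 * n%:R).
  apply: (@circle_full_of_cover _ _ 0) => N e _ e0.
  have [n] := inf (maxn N (maxn Nfull 1)); rewrite !geq_max => /and3P[Nn fn n1] Dn.
  (* A single [n] already covers [0, 1]. *)
  exists n.+1, predT; rewrite (_ : _ `\` _ = set0).
    by rewrite /unit_measure setI0 measure0 ltW.
  apply/seteqP; split=> // x [x01]; case.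
  exact: approx_unionS (Hfull D n fn (D0 n n1) Dn x x01).
have [n1 Hn1] : exists n1, forall n, (n1 <= n)%N -> D n ^+ 2 * n%:R < 1.
  move/existsNP: fin => [n1 Hn1]; exists n1 => n n1n; rewrite ltNge; apply/negP => Dn.
  by apply: Hn1; exists n.
have [n2 Hn2] := scale_large 14; have [n3 Hn3] := overlap_cross_scale R.
pose n0 := maxn (maxn n1 n2) (maxn n3 2).
have n0P n : (n0 <= n)%N -> [/\ (n1 <= n)%N, (n2 <= n)%N, (n3 <= n)%N & (1 < n)%N].
  by rewrite !geq_max => /andP[/andP[-> ->] /andP[-> ->]].
have n0_gt1 : (1 < n0)%N by have [] := n0P n0 (leqnn n0).
have [A [A_lo A_class A_par A_div]] : exists A : pred nat,
    [/\ forall n, A n -> (n0 <= n)%N /\ n%:R ^- 3 <= D n,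
        forall m n, A m -> A n -> scale m = scale n ->
          valuation_class (scale n) m = valuation_class (scale n) n,
        forall m n, A m -> A n -> odd (scale m) = odd (scale n) &
        forall K B, exists X, B <= \sum_(K <= n < X | A n) D n * (totient n)%:R].
  apply: (selection n0_gt1).
  - by move=> n /n0P[_ /Hn2].
  - by move=> n /n0P[nn1 _ _ nn]; split; [exact: D0 (ltnW nn)|exact: Hn1].
  - move=> B; apply: (nneseries_pinfty_unbounded _ sum_infty _ (ltnW n0_gt1)).
    by move=> n n_gt0; rewrite mulr_ge0 // weight_ge0 // D0.
have Dgt0 n : A n -> 0 < D n.
  move=> An; have [n0n Dn] := A_lo n An; have [_ _ _ n_gt1] := n0P n n0n.
  by apply: lt_le_trans Dn; rewrite invr_gt0 exprn_gt0 // ltr0n ltnW.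
(* The constant for equal scales also serves for distinct scales. *)
have C0 : 10 <= 8 * expR 25 :> R by have := @expR_ge1Dx R 25; lra.
have cross m n : A m -> A n -> (scale m < scale n)%N ->
    overlap D n m <= 8 * expR 25 * (D n * (totient n)%:R) * (D m * (totient m)%:R).
  move=> Am An mn; have [n0m Dm] := A_lo m Am; have [n0n _] := A_lo n An.
  have [_ _ _ m_gt1] := n0P m n0m; have [_ _ nn3 n_gt1] := n0P n n0n.
  have mn4 : (m ^ 4 <= n)%N.
    apply: pow4_le_of_scale => //; rewrite ltn_neqAle mn andbT.
    (* Distinct scales of equal parity cannot be consecutive, so they differ by at least 2. *)
    by apply/eqP => E; have := A_par m n Am An; rewrite -E /=; case: (odd _).
  apply: le_trans (Hn3 D n m nn3 m_gt1 mn4 (Dgt0 n An) Dm) _.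
  have h0 j : A j -> 0 <= D j * (totient j)%:R by move=> Aj; rewrite mulr_ge0 // ltW // Dgt0.
  by apply: ler_wpM2r; [exact: h0|apply: ler_wpM2r => //; exact: h0].
apply: (@circle_full_of_cover _ _ n0) => N e n0N e0.
have [M HM] : exists M, unit_measure (`[0, 1]%classic `\` approx_union A D N M) <= e.
  apply: (@cover_of_overlap R A D (8 * expR 25) n0) => //.
  - by move=> n n0n An; split; [exact: Dgt0|have [/Hn1] := n0P n n0n].
  move=> m n n0m n0n Am An; rewrite -/(overlap D m n).
  have [_ _ _ m_gt1] := n0P m n0m; have [_ nn2 _ n_gt1] := n0P n n0n.
  have extra0 : 0 <= (m == n)%:R * (2 * (D n * (totient n)%:R)).
    have h0 := ltW (Dgt0 n An); apply: mulr_ge0 => //; apply: mulr_ge0 => //.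
    exact: mulr_ge0.
  case: (ltngtP (scale m) (scale n)) => mn.
  - rewrite overlapC; apply: le_trans (cross m n Am An mn) _.
    by rewrite mulrAC lerDl.
  - by apply: le_trans (cross n m An Am mn) _; rewrite lerDl.
  have m_b := scale_bounds m_gt1; have n_b := scale_bounds n_gt1; rewrite mn in m_b.
  have m_lt : (1 < m < 2 ^ (4 ^ (scale n).+1))%N by case/andP: m_b => _ ->; rewrite m_gt1.
  have n_lt : (1 < n < 2 ^ (4 ^ (scale n).+1))%N by case/andP: n_b => _ ->; rewrite n_gt1.
  apply: (@overlap_same_scale R D (scale n)) => //; [|by apply: valuation_classP;
    [case/andP: m_lt => /ltnW -> ->|case/andP: n_lt => /ltnW -> ->|exact: A_class]| |].
  - by apply: leq_trans (Hn2 n nn2).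
  - exact: Dgt0.
  - exact: Dgt0.
by exists M, A.
Qed.
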